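(* Let $\mathcal{H}_A,\mathcal{H}_B,\mathcal{H}_C$ be finite-dimensional Hilbert spaces and let $|\psi\rangle_{ABC}\in\mathcal{H}_A\otimes\mathcal{H}_B\otimes\mathcal{H}_C$ be a pure (unit vector) state, with $\rho_{AB}=\mathrm{Tr}_C|\psi\rangle\langle\psi|$. Then $|\psi\rangle_{ABC}$ is a triangle state up to local isometries if and only if $g(A:B)=0$.
   Context: All Hilbert spaces are finite-dimensional complex Hilbert spaces. For a density matrix $\rho$ on a tensor product of parties and a subset $X$ of the parties, $S_X=-\mathrm{Tr}(\rho_X\log\rho_X)$ is the von Neumann entropy of the reduced density matrix on $X$. The mutual information is $I(A:B)=S_A+S_B-S_{AB}$, evaluated on $\rho_{AB}$. Entanglement of purification: $E_P(A:B)=\min_{|\phi\rangle}S_{AC_L}(|\phi\rangle_{ABC_LC_R})$, where the minimum runs over all finite-dimensional auxiliary Hilbert spaces $\mathcal{H}_{C_L},\mathcal{H}_{C_R}$ and all pure states $|\phi\rangle_{ABC_LC_R}\in\mathcal{H}_A\otimes\mathcal{H}_B\otimes\mathcal{H}_{C_L}\otimes\mathcal{H}_{C_R}$ that purify $\rho_{AB}$, i.e. $\mathrm{Tr}_{C_LC_R}|\phi\rangle\langle\phi|=\rho_{AB}$. (It is known that the minimum is attained, with $\dim\mathcal{H}_{C_L},\dim\mathcal{H}_{C_R}\le\mathrm{rank}(\rho_{AB})$.) Define $g(A:B)=2E_P(A:B)-I(A:B)$, which is always $\ge 0$. Triangle state: a pure state $|\psi\rangle_{ABC}\in\mathcal{H}_A\otimes\mathcal{H}_B\otimes\mathcal{H}_C$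 is a triangle state if for each $\alpha\in\{A,B,C\}$ there is a tensor factorization $\mathcal{H}_\alpha=\mathcal{H}_{\alpha_L}\otimes\mathcal{H}_{\alpha_R}$ such that $|\psi\rangle_{ABC}=|\psi\rangle_{A_RB_L}\,|\psi\rangle_{B_RC_L}\,|\psi\rangle_{C_RA_L}$ (a tensor product, with factors suitably reordered), where each $|\psi\rangle_{\alpha_R\beta_L}$ is a pure state in $\mathcal{H}_{\alpha_R}\otimes\mathcal{H}_{\beta_L}$. A state $|\psi\rangle_{ABC}$ is a triangle state up to local isometries if there exist finite-dimensional Hilbert spaces $\mathcal{H}'_A,\mathcal{H}'_B,\mathcal{H}'_C$ and isometries $V_\alpha:\mathcal{H}_\alpha\to\mathcal{H}'_\alpha$ such that $(V_A\otimes V_B\otimes V_C)|\psi\rangle_{ABC}$ is a triangle state in $\mathcal{H}'_A\otimes\mathcal{H}'_B\otimes\mathcal{H}'_C$. *)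

(* Defs.v *)
From HB Require Import structures.
From mathcomp Require Import all_boot all_order all_algebra.
From mathcomp Require Import spectral.
From mathcomp Require Import complex mxtens.
From mathcomp Require Import all_classical all_reals all_analysis.

Set Implicit Arguments.
Unset Strict Implicit.
Unset Printing Implicit Defensive.

Import Order.TTheory GRing.Theory Num.Theory.
Local Open Scope classical_set_scope.
Local Open Scope ring_scope.
Local Open Scope sesquilinear_scope.

(* A finite-dimensional Hilbert space is C^n with its standard inner product,
   where C = R[i].  The tensor product of C^m and C^n is C^(m * n), the product
   basis vector e_i (x) e_j being the basis vector of index mxtens_index (i, j);
   iterated products associate to the left, and *t is the Kronecker product. *)

Definition tens2 m n (i : 'I_m) (j : 'I_n) : 'I_(m * n) := mxtens_index (i, j).

Definition tens3 m n p (i : 'I_m) (j : 'I_n) (k : 'I_p) : 'I_(m * n * p) :=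
  tens2 (tens2 i j) k.

Definition tens4 m n p q (i : 'I_m) (j : 'I_n) (k : 'I_p) (l : 'I_q) :
    'I_(m * n * p * q) :=
  tens2 (tens3 i j k) l.

Section Quantum.
Variable R : realType.

Definition pure_state n (v : 'cV[R[i]]_n) : Prop := v^t* *m v = 1%:M.

Definition density n (v : 'cV[R[i]]_n) : 'M[R[i]]_n := v *m v^t*.

Definition isometry m n (V : 'M[R[i]]_(m, n)) : Prop := V^t* *m V = 1%:M.

Definition unitary m n (U : 'M[R[i]]_(m, n)) : Prop :=
  U^t* *m U = 1%:M /\ U *m U^t* = 1%:M.

Definition ptrace_l m n (rho : 'M[R[i]]_(m * n)) : 'M[R[i]]_n :=
  \matrix_(i, j) \sum_(k < m) rho (tens2 k i) (tens2 k j).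

Definition ptrace_r m n (rho : 'M[R[i]]_(m * n)) : 'M[R[i]]_m :=
  \matrix_(i, j) \sum_(k < n) rho (tens2 i k) (tens2 j k).

(* Functional calculus on the spectral decomposition.  Since ln 0 = 0, the
   kernel of rho contributes nothing to rho *m logmx rho, which is the
   convention 0 log 0 = 0. *)
Definition logmx n (rho : 'M[R[i]]_n) : 'M[R[i]]_n :=
  invmx (spectralmx rho) *m
  diag_mx (map_mx (fun x => (ln (complex.Re x))%:C%C) (spectral_diag rho)) *m
  spectralmx rho.

Definition entropy n (rho : 'M[R[i]]_n) : R :=
  - complex.Re (\tr (rho *m logmx rho)).

Definition mutual_information a b (rho : 'M[R[i]]_(a * b)) : R :=
  entropy (ptrace_r rho) + entropy (ptrace_l rho) - entropy rho.

(* Reduced operator on the first and third of four parties. *)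
Definition marginal13 a b l r (rho : 'M[R[i]]_(a * b * l * r)) :
    'M[R[i]]_(a * l) :=
  \matrix_(s, t)
    let: (i, k) := mxtens_unindex s in let: (i', k') := mxtens_unindex t in
    \sum_(j < b) \sum_(z < r) rho (tens4 i j k z) (tens4 i' j k' z).

Definition purifies a b l r
    (phi : 'cV[R[i]]_(a * b * l * r)) (rho : 'M[R[i]]_(a * b)) : Prop :=
  pure_state phi /\ ptrace_r (ptrace_r (density phi)) = rho.

(* For a density matrix rho the set below is non-empty, bounded below by 0, and
   has a least element, so that its infimum is the minimum over all
   purifications. *)
Definition EP a b (rho : 'M[R[i]]_(a * b)) : R :=
  inf [set s : R | exists (l r : nat) (phi : 'cV[R[i]]_(a * b * l * r)),
    purifies phi rho /\ s = entropy (marginal13 (density phi))].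

Definition g a b (rho : 'M[R[i]]_(a * b)) : R :=
  2 * EP rho - mutual_information rho.

(* The unitaries UA, UB, UC are the identifications of each party's space with
   the tensor product of its L factor and its R factor, in this order. *)
Definition triangle_state a b c (psi : 'cV[R[i]]_(a * b * c)) : Prop :=
  exists (aL aR bL bR cL cR : nat)
         (UA : 'M[R[i]]_(aL * aR, a)) (UB : 'M[R[i]]_(bL * bR, b))
         (UC : 'M[R[i]]_(cL * cR, c))
         (psiAB : 'cV[R[i]]_(aR * bL)) (psiBC : 'cV[R[i]]_(bR * cL))
         (psiCA : 'cV[R[i]]_(cR * aL)),
    [/\ unitary UA, unitary UB & unitary UC] /\
    [/\ pure_state psiAB, pure_state psiBC & pure_state psiCA] /\
    forall (xL : 'I_aL) (xR : 'I_aR) (yL : 'I_bL) (yR : 'I_bR)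
           (zL : 'I_cL) (zR : 'I_cR),
      ((UA *t UB *t UC) *m psi)
        (tens3 (tens2 xL xR) (tens2 yL yR) (tens2 zL zR)) 0 =
      psiAB (tens2 xR yL) 0 * psiBC (tens2 yR zL) 0 * psiCA (tens2 zR xL) 0.

Definition triangle_up_to_isometries a b c (psi : 'cV[R[i]]_(a * b * c)) :
    Prop :=
  exists (a' b' c' : nat) (VA : 'M[R[i]]_(a', a)) (VB : 'M[R[i]]_(b', b))
         (VC : 'M[R[i]]_(c', c)),
    [/\ isometry VA, isometry VB & isometry VC] /\
    triangle_state ((VA *t VB *t VC) *m psi).

End Quantum.

(* Main.v *)
Require Import Defs.
From mathcomp Require Import all_boot all_order all_algebra.
From mathcomp Require Import complex.
From mathcomp Require Import spectral mxtens.
From mathcomp Require Import all_classical all_reals all_analysis.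
From mathcomp Require Import ring lra.

(* Let L and Q be the two halves of the purifying system. By purity,
     2 S(AL) - I(A:B) = I(A:Q|B) + I(L:BQ) = I(B:L|A) + I(Q:AL),
   so g >= 0 by strong subadditivity. If a purification attains g = 0, the equality case of
   ordinary subadditivity gives rho_LBQ = rho_L (x) rho_BQ and rho_QAL = rho_Q (x) rho_AL.
   Purifications are unique up to isometries of the purifying system; hence A splits into a
   purifier of L and a purifier of BQ, B splits into a purifier of Q and a purifier of AL, and
   C embeds into LQ, which is a triangle. Conversely the purification L = C_R, Q = C_L of a
   triangle state satisfies 2 S(AL) = I(A:B).

   Strong subadditivity follows from the monotonicity of the relative entropy, obtained by
   integrating over s > 0 the variational expression
     sup_Z (2 Re tr (rho Z^* ) - tr (sigma Z Z^* ) - s tr (rho Z^* Z)),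
   which decreases when Z is restricted to operators Z' (x) 1.

   The infimum in E_P is attained. Reweighting a basis of Q, Klein's inequality with the
   original rho_AL as reference bounds the new S(AL) by a linear function of the weights, so a
   sparse solution of a linear program bounds dim Q, and exchanging the roles of A, L and B, Q
   bounds dim L. In fixed dimensions one minimises over pairs (purification, orthonormal basis
   of AL) the Shannon entropy of the diagonal of rho_AL in this basis: a continuous function on
   a compact set. *)

Set Implicit Arguments.
Unset Strict Implicit.
Unset Printing Implicit Defensive.

Import Order.TTheory GRing.Theory Num.Theory.
Import numFieldNormedType.Exports.
Local Open Scope ring_scope.
Local Open Scope sesquilinear_scope.

(** * Matrices indexed by finite types *)

Section Kernels.
Variable R : realType.
Local Notation C := R[i].

(** Amplitudes replace density matrices: a state is an array [M : T -> U -> C], its reduced state on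
    [T] is [gram M], and every entropy is [vN] of some cut. Positivity is then built in, and
    regrouping parties is a bijection of index types. Two obstacles shape the proof. The states may
    be singular, so a decomposition lists positive eigenvalues only, and an inclusion of supports is
    written [F ** (adj F ** E) = E]; every logarithm that occurs is then taken at a positive number,
    without regularisation. And [entropy] is computed from one chosen diagonalisation; [Ent_uniq]
    allows any other one in its place, and the minimisation over bases avoids following eigenvectors
    as the state varies. In the triangle built from an optimal purification [phi], the three edge
    states are all copies of [phi], cut as AL against BQ, ABL against Q, and L against ABQ. The
    isometries produced by uniqueness of purifications land in a direct sum rather than a tensor
    product, so the copies are padded by zeros. *)

Definition nsq (z : C) : R := complex.Re z ^+ 2 + complex.Im z ^+ 2.

Lemma nsqE (z : C) : (nsq z)%:C%C = z * z^*.
Proof.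
by case: z => x y; apply/eqP; rewrite eq_complex /nsq /=; apply/andP; split; apply/eqP; ring.
Qed.

Lemma nsq_ge0 (z : C) : 0 <= nsq z.
Proof. by rewrite addr_ge0 ?sqr_ge0. Qed.

Lemma nsq_eq0 (z : C) : nsq z = 0 -> z = 0.
Proof.
move=> /eqP; rewrite paddr_eq0 ?sqr_ge0// !sqrf_eq0 => /andP[/eqP r0 /eqP i0].
by apply/eqP; rewrite eq_complex r0 i0 /= eqxx.
Qed.

Lemma conjC_realC (x : R) : (x%:C%C : C)^* = x%:C%C.
Proof. by apply/eqP; rewrite eq_complex /= oppr0 !eqxx. Qed.

Lemma ReZ (x : R) (z : C) : complex.Re (x%:C%C * z) = x * complex.Re z.
Proof. by case: z => a b /=; rewrite mul0r subr0. Qed.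

Lemma Re_sum (I : Type) (r : seq I) (P : pred I) (F : I -> C) :
  complex.Re (\sum_(i <- r | P i) F i) = \sum_(i <- r | P i) complex.Re (F i).
Proof. exact: (big_morph _ (id1 := 0) (@raddfD _ _ (@complex.Re R : {additive _ -> _}))). Qed.

Lemma sum_sig (I : finType) (Q : pred I) (V : nmodType) (F : I -> V) :
  \sum_(i | Q i) F i = \sum_(k : {i | Q i}) F (val k).
Proof.
rewrite (reindex_omap (val : {i | Q i} -> I) insub) /=; last by move=> i Qi; rewrite insubT.
by apply: eq_bigl => k; rewrite valK (valP k) eqxx.
Qed.

Definition fmul (T U V : finType) (f : T -> U -> C) (g : U -> V -> C) : T -> V -> C :=
  fun t v => \sum_u f t u * g u v.

Definition adj (T U : Type) (f : T -> U -> C) : U -> T -> C := fun u t => (f t u)^*.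

Definition dg (K : eqType) (p : K -> R) : K -> K -> C :=
  fun k k' => if k == k' then (p k)%:C%C else 0.

Definition fid (T : eqType) : T -> T -> C := fun t t' => (t == t')%:R.

Definition ftr (T : finType) (f : T -> T -> C) : C := \sum_t f t t.

Definition fsub (T U : Type) (f g : T -> U -> C) : T -> U -> C := fun t u => f t u - g t u.

Definition fnsq (T U : finType) (f : T -> U -> C) : R := \sum_t \sum_u nsq (f t u).

Definition gram (T U : finType) (M : T -> U -> C) : T -> T -> C := fmul M (adj M).

Local Notation "f ** g" := (fmul f g) (at level 40, left associativity).

Lemma fext (T U : Type) (f g : T -> U -> C) : (forall t u, f t u = g t u) -> f = g.
Proof. by move=> H; apply/funext => t; apply/funext => u. Qed.

Lemma fmulA (T U V W : finType) (f : T -> U -> C) (g : U -> V -> C) (h : V -> W -> C) :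
  f ** (g ** h) = f ** g ** h.
Proof.
apply: fext => t w; rewrite /fmul.
under eq_bigr do rewrite big_distrr /=.
under [RHS]eq_bigr do rewrite big_distrl /=.
by rewrite exchange_big /=; apply: eq_bigr => v _; apply: eq_bigr => u _; rewrite mulrA.
Qed.

Lemma adjK (T U : Type) (f : T -> U -> C) : adj (adj f) = f.
Proof. by apply: fext => t u; rewrite /adj conjCK. Qed.

Lemma adjM (T U V : finType) (f : T -> U -> C) (g : U -> V -> C) :
  adj (f ** g) = adj g ** adj f.
Proof.
apply: fext => v t; rewrite /adj /fmul rmorph_sum /=.
by apply: eq_bigr => u _; rewrite rmorphM mulrC.
Qed.

Lemma sum_delta (T : finType) (F : T -> C) (t : T) :
  \sum_u (t == u)%:R * F u = F t.
Proof.
rewrite (bigD1 t) //= eqxx mul1r big1 ?addr0 // => u; rewrite eq_sym => /negPf ->.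
by rewrite mul0r.
Qed.

Lemma fmul1l (T U : finType) (f : T -> U -> C) : @fid T ** f = f.
Proof. by apply: fext => t u; rewrite /fmul /fid sum_delta. Qed.

Lemma fmul1r (T U : finType) (f : T -> U -> C) : f ** @fid U = f.
Proof.
apply: fext => t u; rewrite /fmul /fid -[RHS](sum_delta (f t) u).
by apply: eq_bigr => v _; rewrite mulrC eq_sym.
Qed.

Lemma fmul_dgl (K U : finType) (p : K -> R) (f : K -> U -> C) :
  dg p ** f = fun k u => (p k)%:C%C * f k u.
Proof.
apply: fext => k u; rewrite /fmul /dg (bigD1 k) //= eqxx big1 ?addr0 // => l.
by rewrite eq_sym => /negPf ->; rewrite mul0r.
Qed.

Lemma fmul_dgr (K U : finType) (p : K -> R) (f : U -> K -> C) :
  f ** dg p = fun u k => f u k * (p k)%:C%C.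
Proof.
apply: fext => u k; rewrite /fmul /dg (bigD1 k) //= eqxx big1 ?addr0 // => l.
by move=> /negPf ->; rewrite mulr0.
Qed.

Lemma adj_dg (K : eqType) (p : K -> R) : adj (dg p) = dg p.
Proof.
apply: fext => k l; rewrite /adj /dg eq_sym; case: eqP => [->|_]; last exact: conjC0.
exact: conjC_realC.
Qed.

Lemma adj_fid (T : finType) : adj (@fid T) = @fid T.
Proof. by apply: fext => k l; rewrite /adj /fid eq_sym rmorph_nat. Qed.

Lemma ftrC (T U : finType) (f : T -> U -> C) (g : U -> T -> C) : ftr (f ** g) = ftr (g ** f).
Proof.
rewrite /ftr /fmul exchange_big /=; apply: eq_bigr => u _; apply: eq_bigr => t _.
exact: mulrC.
Qed.

Lemma ftr_gram (T U : finType) (M : T -> U -> C) : ftr (gram M) = (fnsq M)%:C%C.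
Proof.
rewrite /ftr /gram /fmul /fnsq rmorph_sum /=; apply: eq_bigr => t _.
by rewrite rmorph_sum /=; apply: eq_bigr => u _; rewrite nsqE.
Qed.

Lemma fnsq_ge0 (T U : finType) (M : T -> U -> C) : 0 <= fnsq M.
Proof. by apply: sumr_ge0 => t _; apply: sumr_ge0 => u _; exact: nsq_ge0. Qed.

Lemma fnsq_eq0 (T U : finType) (M : T -> U -> C) t u : fnsq M = 0 -> M t u = 0.
Proof.
move=> /eqP; rewrite psumr_eq0; last first.
  by move=> *; apply: sumr_ge0 => *; exact: nsq_ge0.
move=> /allP /(_ t (mem_index_enum t)) /=; rewrite psumr_eq0; last first.
  by move=> *; exact: nsq_ge0.
by move=> /allP /(_ u (mem_index_enum u)) /= /eqP /nsq_eq0.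
Qed.

Lemma fmulBl (T U V : finType) (f g : T -> U -> C) (h : U -> V -> C) :
  fsub f g ** h = fsub (f ** h) (g ** h).
Proof.
apply: fext => t v; rewrite /fsub /fmul -sumrB; apply: eq_bigr => u _.
exact: mulrBl.
Qed.

Lemma fmulBr (T U V : finType) (h : T -> U -> C) (f g : U -> V -> C) :
  h ** fsub f g = fsub (h ** f) (h ** g).
Proof.
apply: fext => t v; rewrite /fsub /fmul -sumrB; apply: eq_bigr => u _.
exact: mulrBr.
Qed.

Lemma adjB (T U : Type) (f g : T -> U -> C) : adj (fsub f g) = fsub (adj f) (adj g).
Proof. by apply: fext => t u; rewrite /adj /fsub rmorphB. Qed.

Lemma ftrB (T : finType) (f g : T -> T -> C) : ftr (fsub f g) = ftr f - ftr g.
Proof. exact: sumrB. Qed.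

(** Pythagoras for the orthogonal projection [F ** adj F]: by cyclicity of the trace, both mixed
    terms and the projected square are equal. *)
Lemma fnsq_proj (T K U : finType) (F : T -> K -> C) (M : T -> U -> C) :
  adj F ** F = @fid K ->
  fnsq (fsub M (F ** (adj F ** M))) = fnsq M - fnsq (adj F ** M).
Proof.
move=> FF; apply: complexI; rewrite -ftr_gram rmorphB /= -!ftr_gram /gram.
rewrite adjB fmulBl !fmulBr ftrB !ftrB !adjM !adjK.
have e1 : ftr (M ** (adj M ** F ** adj F)) = ftr (adj F ** M ** (adj M ** F)).
  by rewrite !fmulA ftrC !fmulA.
have e2 : ftr (F ** (adj F ** M) ** adj M) = ftr (adj F ** M ** (adj M ** F)).
  by rewrite -!fmulA ftrC !fmulA.
have e3 : ftr (F ** (adj F ** M) ** (adj M ** F ** adj F)) = ftr (adj F ** M ** (adj M ** F)).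
  by rewrite -!fmulA ftrC -!fmulA FF fmul1r !fmulA.
by rewrite e1 e2 e3 subrr subr0.
Qed.

Lemma bessel (T K U : finType) (F : T -> K -> C) (M : T -> U -> C) :
  adj F ** F = @fid K -> fnsq (adj F ** M) <= fnsq M.
Proof. by move=> FF; rewrite -subr_ge0 -fnsq_proj // fnsq_ge0. Qed.

(** Equality in Bessel's inequality serves below to show that the columns of [F] span those of [M]:
    a count of norms in place of a comparison of subspaces. *)
Lemma bessel_eq (T K U : finType) (F : T -> K -> C) (M : T -> U -> C) :
  adj F ** F = @fid K -> fnsq (adj F ** M) = fnsq M -> F ** (adj F ** M) = M.
Proof.
move=> FF e; apply: fext => t u; apply/esym/eqP; rewrite -subr_eq0; apply/eqP.
apply: (@fnsq_eq0 _ _ (fsub M (F ** (adj F ** M))) t u).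
by rewrite fnsq_proj // e subrr.
Qed.

(* Only the nonzero eigenvalues are listed, so that the eigenvectors [E] need not be complete. *)
Record sdec (T K : finType) (rho : T -> T -> C) (p : K -> R) (E : T -> K -> C) : Prop := SDec {
  sdec_gt0 : forall k, 0 < p k;
  sdec_on : adj E ** E = @fid K;
  sdec_eq : rho = E ** (dg p ** adj E) }.

Definition Ent (K : finType) (p : K -> R) : R := - \sum_k p k * ln (p k).

Lemma sdec_mul (T K : finType) (rho : T -> T -> C) (p : K -> R) (E : T -> K -> C) :
  sdec rho p E -> rho ** E = E ** dg p.
Proof. by case=> _ on ->; rewrite -!fmulA on fmul1r. Qed.

Lemma dg_cancel (T K : finType) (p : K -> R) (X Y : T -> K -> C) :
  (forall k, 0 < p k) -> X ** dg p = Y ** dg p -> X = Y.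
Proof.
move=> p0 e; apply: fext => t k; have := congr1 (fun f => f t k) e.
rewrite !fmul_dgr => /mulIf; apply.
by apply/eqP => /complexI /eqP; rewrite gt_eqF.
Qed.

(** [E] is recovered from [rho ** E] by dividing out the positive eigenvalues, and the range of
    [rho] lies in the span of [F]. *)
Lemma sdec_same_support (T K J : finType) (rho : T -> T -> C) (p : K -> R) (E : T -> K -> C)
    (q : J -> R) (F : T -> J -> C) :
  sdec rho p E -> sdec rho q F -> F ** (adj F ** E) = E.
Proof.
move=> dE dF; apply: (dg_cancel (sdec_gt0 dE)).
rewrite -!fmulA -(sdec_mul dE) (sdec_eq dF) !fmulA.
by rewrite -[F ** adj F ** F]fmulA (sdec_on dF) fmul1r.
Qed.

Lemma col_nsq (J K : finType) (u : J -> K -> C) k :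
  (adj u ** u) k k = (\sum_j nsq (u j k))%:C%C.
Proof. by rewrite /fmul /adj rmorph_sum; apply: eq_bigr => j _ /=; rewrite nsqE mulrC. Qed.

Lemma support_col (T J K : finType) (E : T -> K -> C) (F : T -> J -> C) :
  adj E ** E = @fid K -> F ** (adj F ** E) = E ->
  forall k, \sum_j nsq ((adj F ** E) j k) = 1.
Proof.
move=> EE FE k; apply: complexI; rewrite -col_nsq adjM adjK -!fmulA FE EE.
by rewrite /fid eqxx.
Qed.

(** The squared overlaps of the two eigenbases form a doubly stochastic matrix, and a nonzero
    overlap forces equal eigenvalues because the overlap matrix intertwines the two diagonals. Hence
    [Ent] depends on [rho] alone. *)
Lemma Ent_uniq (T K J : finType) (rho : T -> T -> C) (p : K -> R) (E : T -> K -> C)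
    (q : J -> R) (F : T -> J -> C) :
  sdec rho p E -> sdec rho q F -> Ent p = Ent q.
Proof.
move=> dE dF; pose u := adj F ** E.
have uE k : \sum_j nsq (u j k) = 1.
  exact: support_col (sdec_on dE) (sdec_same_support dE dF) k.
have uF j : \sum_k nsq (u j k) = 1.
  rewrite -[RHS](support_col (sdec_on dF) (sdec_same_support dF dE) j).
  apply: eq_bigr => k _; apply: complexI; rewrite !nsqE.
  have -> : (adj E ** F) k j = adj u k j by rewrite /u adjM adjK.
  by rewrite /adj conjCK mulrC.
have qu : dg q ** u = u ** dg p.
  rewrite /u -fmulA -(sdec_mul dE) (sdec_eq dF) !fmulA (sdec_on dF).
  by rewrite fmul1l.
have pq j k : nsq (u j k) * (p k * ln (p k)) = nsq (u j k) * (q j * ln (q j)).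
  have := congr1 (fun f => f j k) qu; rewrite fmul_dgl fmul_dgr mulrC => e.
  have [u0|u0] := eqVneq (u j k) 0; first by rewrite u0 /nsq /= expr0n /= addr0 !mul0r.
  by move: e => /(mulfI u0) /complexI ->.
rewrite /Ent; congr (- _).
transitivity (\sum_k \sum_j nsq (u j k) * (p k * ln (p k))).
  by apply: eq_bigr => k _; rewrite -big_distrl /= uE mul1r.
rewrite exchange_big /=; apply: eq_bigr => j _.
under eq_bigr do rewrite pq.
by rewrite -big_distrl /= uF mul1r.
Qed.

Lemma sdec_reindex (T T' K : finType) (rho : T -> T -> C) (p : K -> R) (E : T -> K -> C)
    (h : T' -> T) : bijective h ->
  sdec rho p E -> sdec (fun i j => rho (h i) (h j)) p (fun i => E (h i)).
Proof.
move=> bh [p0 on e]; split=> //.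
  rewrite -on; apply: fext => k l; rewrite /fmul /adj.
  by rewrite [RHS](reindex h) //=; exact: onW_bij.
by rewrite e; apply: fext.
Qed.

(** A Gram matrix is normal, so the spectral theorem applies, and its diagonal form is again a Gram
    matrix, that of [P *m X]. The eigenvalues are therefore real and nonnegative, and [entropy],
    which reads only their real parts, is the expected sum. *)
Lemma spectral_gram (n : nat) (U : finType) (M : 'I_n -> U -> C) (A : 'M[C]_n) :
  (forall i j, A i j = gram M i j) ->
  let P := spectralmx A in let d i := complex.Re (spectral_diag A 0 i) in
  [/\ P *m P^t* = 1%:M, P^t* *m P = 1%:M,
      forall i, 0 <= d i /\ (d i)%:C%C = spectral_diag A 0 i,
      A = P^t* *m diag_mx (spectral_diag A) *m P &
      entropy A = - \sum_i d i * ln (d i)].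
Proof.
move=> AE P re.
have PU := spectral_unitarymx A.
set d := spectral_diag A in re *.
pose X : 'M[C]_(n, #|U|) := \matrix_(i, j) M i (enum_val j).
have AX : A = X *m X^t*.
  apply/matrixP => i j; rewrite AE mxE /gram /fmul (reindex_onto enum_val enum_rank) /=; last first.
    by move=> u _; rewrite enum_rankK.
  rewrite [LHS](eq_bigl predT); last by move=> u; rewrite enum_valK eqxx.
  by apply: eq_bigr => u _; rewrite !mxE.
have nA : A \is normalmx.
  apply/normalmxP; have -> : A^t* = A by rewrite AX trmx_mul map_mxM trmxCK.
  by [].
have /orthomx_spectralP Aeq := nA; rewrite -/P -/d in Aeq.
have iP : invmx P = P^t* by exact: invmx_unitary.
have PP : P *m P^t* = 1%:M by apply/eqP; exact: PU.
have Pu : P \in unitmx by exact: unitarymx_unit.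
have dE : diag_mx d = (P *m X) *m (P *m X)^t*.
  rewrite trmx_mul map_mxM -[RHS]mulmxA (mulmxA X) -AX Aeq iP !mulmxA PP mul1mx.
  by rewrite -mulmxA PP mulmx1.
have d_ge0 i : 0 <= d 0 i.
  have -> : d 0 i = diag_mx d i i by rewrite mxE eqxx mulr1n.
  rewrite dE mxE sumr_ge0 // => j _; rewrite !mxE -normCK; exact: exprn_ge0.
have d_re i : (re i)%:C%C = d 0 i by rewrite RRe_real // ger0_real.
split=> //.
- by rewrite -iP mulVmx.
- by move=> i; split=> //; rewrite -lecR d_re.
- by rewrite -iP.
rewrite /entropy /logmx -/P -/d; congr (- _).
rewrite {1}Aeq !mulmxA mulmxK // -!mulmxA mxtrace_mulC -!mulmxA mulmxV // mulmx1.
rewrite /mxtrace Re_sum; apply: eq_bigr => i _.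
by rewrite mul_diag_mx !mxE eqxx mulr1n -{1}d_re ReZ.
Qed.

(** Discarding the zero eigenvalues changes neither the matrix nor the entropy, to which each
    contributes [0 * ln 0 = 0]. *)
Lemma sdec_spectral (n : nat) (U : finType) (M : 'I_n -> U -> C) (A : 'M[C]_n) :
  (forall i j, A i j = gram M i j) ->
  let K := {i : 'I_n | complex.Re (spectral_diag A 0 i) != 0} in
  let p (k : K) := complex.Re (spectral_diag A 0 (val k)) in
  exists E : 'I_n -> K -> C, sdec (gram M) p E /\ entropy A = Ent p.
Proof.
move=> AE K p; have [PP _ d_re Aeq eA] := spectral_gram AE.
set P := spectralmx A in PP Aeq; set d := spectral_diag A in d_re Aeq eA K p *.
pose E (i : 'I_n) (k : K) : C := (P (val k) i)^*.
exists E; split; last first.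
  rewrite eA /Ent; congr (- _).
  rewrite [LHS](bigID (fun i => complex.Re (d 0 i) != 0)) /= [X in _ + X]big1; last first.
    by move=> i /negPn/eqP e; rewrite e mul0r.
  by rewrite addr0 sum_sig.
split.
- by move=> k; rewrite lt0r (d_re _).1 (valP k).
- apply: fext => k l; rewrite /fmul /adj /E.
  transitivity ((P *m P^t*) (val k) (val l)).
    by rewrite mxE; apply: eq_bigr => i _; rewrite !mxE conjCK.
  by rewrite PP mxE /fid val_eqE.
apply: fext => i j; rewrite -AE fmul_dgl {1}Aeq -mulmxA mul_diag_mx mxE /fmul.
rewrite (bigID (fun i => complex.Re (d 0 i) != 0)) /= [X in _ + X]big1; last first.
  by move=> k /negPn/eqP e; rewrite !mxE -(d_re k).2 e mul0r mulr0.
rewrite addr0 sum_sig; apply: eq_bigr => k _.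
by rewrite !mxE /adj /E conjCK (d_re _).2.
Qed.

End Kernels.

Local Notation "f ** g" := (fmul f g) (at level 40, left associativity).

(** * Entropy of a bipartite pure state *)

Section EntropyOfGram.
Variable R : realType.
Local Notation C := R[i].

(** The entropy on [T] of the pure state of [T] and [U] with amplitudes [M]. The matrix needs
    ordinal indices; by [vN_sdec] the enumeration does not affect the value. *)
Definition vN (T U : finType) (M : T -> U -> C) : R :=
  entropy (\matrix_(i < #|T|, j < #|T|) gram M (enum_val i) (enum_val j)).

Lemma sdec_exists (T U : finType) (M : T -> U -> C) :
  exists (K : finType) (p : K -> R) (E : T -> K -> C), sdec (gram M) p E /\ vN M = Ent p.
Proof.
have AE i j : (\matrix_(i < #|T|, j < #|T|) gram M (enum_val i) (enum_val j)) i j =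
    gram (fun i : 'I_#|T| => M (enum_val i)) i j by rewrite mxE.
have [E [dE eE]] := sdec_spectral AE.
have := sdec_reindex (@enum_rank_bij T) dE.
rewrite [X in sdec X](_ : _ = gram M); last first.
  by apply: fext => i j; apply: eq_bigr => u _; rewrite /adj !enum_rankK.
by move=> dE'; do 3 eexists; split; [exact: dE'|exact: eE].
Qed.

Lemma vN_sdec (T U K : finType) (M : T -> U -> C) (p : K -> R) (E : T -> K -> C) :
  sdec (gram M) p E -> vN M = Ent p.
Proof. by move=> dE; have [K' [p' [E' [dE' ->]]]] := sdec_exists M; exact: Ent_uniq dE' dE. Qed.

Lemma entropy_gram (n : nat) (T U : finType) (h : 'I_n -> T) (M : T -> U -> C) (A : 'M[C]_n) :
  bijective h -> (forall i j, A i j = gram M (h i) (h j)) -> entropy A = vN M.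
Proof.
move=> bh AE; have [E [dE ->]] := sdec_spectral (M := fun i => M (h i)) AE.
have [K' [p' [E' [dE' ->]]]] := sdec_exists M.
exact: Ent_uniq dE (sdec_reindex bh dE').
Qed.

Lemma vN_gram (T U U' : finType) (M : T -> U -> C) (N : T -> U' -> C) :
  gram M = gram N -> vN M = vN N.
Proof. by rewrite /vN => ->. Qed.

Lemma vN_bij (T T' U U' : finType) (g : T' -> T) (h : U' -> U) (M : T -> U -> C) :
  bijective g -> bijective h -> vN (fun t u => M (g t) (h u)) = vN M.
Proof.
move=> bg bh; have [K [p [E [dE ->]]]] := sdec_exists M.
apply: (@vN_sdec _ _ _ _ p (fun i => E (g i))).
rewrite [X in sdec X](_ : _ = fun i j => gram M (g i) (g j)); first exact: sdec_reindex.
apply: fext => i j; rewrite /gram /fmul [RHS](reindex h) //.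
exact: onW_bij.
Qed.

Lemma vN_isometry (T T' U : finType) (W : T' -> T -> C) (M : T -> U -> C) :
  adj W ** W = @fid R T -> vN (W ** M) = vN M.
Proof.
move=> WW; have [K [p [E [dE ->]]]] := sdec_exists M.
apply: (@vN_sdec _ _ _ _ p (W ** E)); case: dE => p0 on e; split=> //.
  by rewrite adjM -fmulA (fmulA (adj W)) WW fmul1l.
by rewrite /gram !adjM -fmulA (fmulA M) -/(gram M) e !fmulA.
Qed.

(** Compressing [gram M] to the span of its eigenvectors [E] keeps the whole trace, so Bessel's
    inequality is an equality. *)
Lemma gram_support (T U K : finType) (M : T -> U -> C) (p : K -> R) (E : T -> K -> C) :
  sdec (gram M) p E -> E ** (adj E ** M) = M.
Proof.
move=> dE; have on := sdec_on dE; apply: bessel_eq => //; apply: complexI.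
rewrite -!ftr_gram {1}/gram adjM adjK -fmulA (fmulA M) -/(gram M) (sdec_mul dE).
by rewrite fmulA on fmul1l (sdec_eq dE) [RHS]ftrC -fmulA on fmul1r.
Qed.

Lemma sdec_support (T U K J : finType) (M : T -> U -> C) (p : K -> R) (E : T -> K -> C)
    (F : T -> J -> C) :
  sdec (gram M) p E -> F ** (adj F ** M) = M -> F ** (adj F ** E) = E.
Proof.
move=> dE FM; apply: (dg_cancel (sdec_gt0 dE)); rewrite -!fmulA -(sdec_mul dE).
by rewrite !fmulA; congr (_ ** E); rewrite -(fmulA F) FM.
Qed.

Definition trp (T U : Type) (f : T -> U -> C) : U -> T -> C := fun u t => f t u.

Lemma trpM (T U V : finType) (f : T -> U -> C) (g : U -> V -> C) :
  trp (f ** g) = trp g ** trp f.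
Proof. by apply: fext => v t; apply: eq_bigr => u _; rewrite mulrC. Qed.

Lemma trp_fid (T : finType) : trp (@fid R T) = @fid R T.
Proof. by apply: fext => v t; rewrite /trp /fid eq_sym. Qed.

Lemma trp_dg (T : finType) (p : T -> R) : trp (dg p) = dg p.
Proof. by apply: fext => v t; rewrite /trp /dg eq_sym; case: eqP => [->|]. Qed.

Lemma dg_mul (T : finType) (p q : T -> R) : dg p ** dg q = dg (fun k => p k * q k).
Proof.
rewrite fmul_dgl; apply: fext => k l; rewrite /dg; case: eqP => [->|_].
  by rewrite rmorphM.
by rewrite mulr0.
Qed.

Lemma dg1 (T : finType) : dg (fun _ => 1) = @fid R T.
Proof. by apply: fext => k l; rewrite /dg /fid; case: eqP. Qed.

(** Both sides of a pure state have the same entropy. This is the Schmidt decomposition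
    [M = E ** dg r ** G] with [r] the square root of [p] and [G] with orthonormal rows: the
    transpose has the same nonzero spectrum. *)
Lemma vN_trp (T U : finType) (M : T -> U -> C) : vN (trp M) = vN M.
Proof.
have [K [p [E [dE ->]]]] := sdec_exists M.
have p0 := sdec_gt0 dE; have on := sdec_on dE.
pose r k := Num.sqrt (p k).
have r2 k : r k * r k = p k by rewrite -expr2 sqr_sqrtr // ltW.
have r_neq0 k : r k != 0 by rewrite gt_eqF // sqrtr_gt0.
have rr : dg (fun k => (r k)^-1) ** dg r = @fid R K.
  by rewrite dg_mul -dg1; congr dg; apply/funext => k; rewrite mulVf.
have rr' : dg r ** dg (fun k => (r k)^-1) = @fid R K.
  by rewrite dg_mul -dg1; congr dg; apply/funext => k; rewrite mulfV.
have pr : dg p = dg r ** dg r by rewrite dg_mul; congr dg; apply/funext => k; rewrite r2.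
pose G := dg (fun k => (r k)^-1) ** (adj E ** M).
have ME : M = E ** dg r ** G.
  by rewrite /G !fmulA -(fmulA E) rr' fmul1r -fmulA (gram_support dE).
have GG : G ** adj G = @fid R K.
  rewrite /G !adjM adjK adj_dg -!fmulA (fmulA M) -/(gram M) (fmulA (gram M)) (sdec_mul dE).
  by rewrite -(fmulA E) (fmulA (adj E)) on fmul1l pr -(fmulA (dg r)) rr' fmul1r rr.
clearbody G.
apply: (@vN_sdec _ _ _ _ p (trp G)); split=> //.
  by rewrite -[RHS]trp_fid -GG trpM.
have EE : trp E ** adj (trp E) = @fid R K by rewrite -[RHS]trp_fid -on (trpM (adj E) E).
rewrite {1}/gram {1 2}ME !trpM trp_dg !adjM adj_dg -!fmulA; congr (_ ** _).
by rewrite pr -!fmulA; congr (_ ** _); rewrite (fmulA (trp E)) EE fmul1l.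
Qed.

Lemma vN_pure (T : finType) (v : T -> unit -> C) : fnsq v = 1 -> vN v = 0.
Proof.
move=> v1; rewrite (@vN_sdec _ _ unit v (fun _ => 1) v).
  by rewrite /Ent ln1 mulr0 big1 ?oppr0.
split=> //; last by rewrite dg1 fmul1l.
apply: fext => -[] []; rewrite /fid eqxx /=.
transitivity (ftr (adj v ** v)); first by rewrite /ftr (bigD1 tt) //= big1 ?addr0 // => -[].
by rewrite ftrC -/(gram v) ftr_gram v1.
Qed.

Definition kron (T U T' U' : Type) (f : T -> U -> C) (g : T' -> U' -> C) :
    T * T' -> U * U' -> C := fun t u => f t.1 u.1 * g t.2 u.2.

Lemma kron_mul (T U V T' U' V' : finType) (f : T -> U -> C) (f' : U -> V -> C)
    (g : T' -> U' -> C) (g' : U' -> V' -> C) :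
  kron f g ** kron f' g' = kron (f ** f') (g ** g').
Proof.
apply: fext => t v; rewrite /kron /fmul big_distrlr /= pair_bigA /=.
by apply: eq_bigr => u _; rewrite mulrACA.
Qed.

Lemma adj_kron (T U T' U' : Type) (f : T -> U -> C) (g : T' -> U' -> C) :
  adj (kron f g) = kron (adj f) (adj g).
Proof. by apply: fext => t u; rewrite /adj /kron rmorphM. Qed.

Lemma kron_fid (T T' : finType) : kron (@fid R T) (@fid R T') = @fid R (T * T')%type.
Proof. by apply: fext => -[t t'] [u u']; rewrite /kron /fid xpair_eqE /= -natrM mulnb. Qed.

Lemma kron_dg (T T' : finType) (p : T -> R) (q : T' -> R) :
  kron (dg p) (dg q) = dg (fun k => p k.1 * q k.2).
Proof.
apply: fext => -[t t'] [u u']; rewrite /kron /dg xpair_eqE /=.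
by case: eqP; case: eqP; rewrite /= ?mulr0 ?mul0r // rmorphM.
Qed.

Lemma gram_kron (T U T' U' : finType) (f : T -> U -> C) (g : T' -> U' -> C) :
  gram (kron f g) = kron (gram f) (gram g).
Proof. by rewrite /gram adj_kron kron_mul. Qed.

Lemma sdec_kron (T T' K K' : finType) (rho : T -> T -> C) (rho' : T' -> T' -> C)
    (p : K -> R) (p' : K' -> R) (E : T -> K -> C) (E' : T' -> K' -> C) :
  sdec rho p E -> sdec rho' p' E' ->
  sdec (kron rho rho') (fun k : K * K' => p k.1 * p' k.2) (kron E E').
Proof.
move=> [p0 on ->] [p0' on' ->]; split.
- by move=> k; rewrite mulr_gt0.
- by rewrite adj_kron kron_mul on on' kron_fid.
by rewrite -kron_dg adj_kron !kron_mul.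
Qed.

Lemma sdec_trace (T K : finType) (rho : T -> T -> C) (p : K -> R) (E : T -> K -> C) :
  sdec rho p E -> ftr rho = (\sum_k p k)%:C%C.
Proof.
move=> [_ on ->]; rewrite ftrC -fmulA on fmul1r /ftr rmorph_sum.
by apply: eq_bigr => k _; rewrite /dg eqxx.
Qed.

Lemma sdec_gram_sum (T U K : finType) (M : T -> U -> C) (p : K -> R) (E : T -> K -> C) :
  sdec (gram M) p E -> \sum_k p k = fnsq M.
Proof. by move=> /sdec_trace; rewrite ftr_gram => /complexI. Qed.

Lemma vN_kron (T U T' U' : finType) (f : T -> U -> C) (g : T' -> U' -> C) :
  fnsq f = 1 -> fnsq g = 1 -> vN (kron f g) = vN f + vN g.
Proof.
move=> f1 g1; have [K [p [E [dE ->]]]] := sdec_exists f.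
have [K' [p' [E' [dE' ->]]]] := sdec_exists g.
have := sdec_kron dE dE'; rewrite -gram_kron => /vN_sdec ->.
have p0 := sdec_gt0 dE; have p0' := sdec_gt0 dE'.
rewrite /Ent -opprD; congr (- _).
rewrite -(pair_bigA _ (fun k k' => p k * p' k' * ln (p k * p' k'))) /=.
transitivity (\sum_k \sum_k' (p' k' * (p k * ln (p k)) + p k * (p' k' * ln (p' k')))).
  apply: eq_bigr => k _; apply: eq_bigr => k' _; rewrite lnM ?posrE //; ring.
have s1 := sdec_gram_sum dE; have s2 := sdec_gram_sum dE'; rewrite f1 in s1; rewrite g1 in s2.
transitivity (\sum_k (p k * ln (p k) + p k * \sum_k' p' k' * ln (p' k'))).
  by apply: eq_bigr => k _; rewrite big_split /= -big_distrl -big_distrr /= s2 mul1r.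
by rewrite big_split /= -big_distrl /= s1 mul1r.
Qed.

End EntropyOfGram.

#[global] Opaque vN.

(** * Scalar inequalities for the logarithm *)

Section RealLemmas.
Variable R : realType.

Lemma ln_lt_sub1 (x : R) : 0 < x -> x != 1 -> ln x < x - 1.
Proof.
move=> x0 x1; have l0 : ln x != 0 by rewrite ln_eq0.
by have := expR_gt1Dx l0; rewrite lnK ?posrE //; lra.
Qed.

Lemma klein_scalar (p q : R) : 0 < p -> 0 < q -> p - q <= p * (ln p - ln q).
Proof.
move=> p0 q0; have qp : 0 < q / p by rewrite divr_gt0.
have h : ln (q / p) <= q / p - 1.
  have := @le_ln1Dx R (q / p - 1); rewrite addrCA subrr addr0; apply; lra.
move: h; rewrite ln_div ?posrE // => h.
have : p * (ln q - ln p) <= p * (q / p - 1) by rewrite ler_pM2l.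
have -> : p * (q / p - 1) = q - p by field; rewrite gt_eqF.
lra.
Qed.

Lemma klein_scalar_eq (p q : R) : 0 < p -> 0 < q -> p * (ln p - ln q) = p - q -> p = q.
Proof.
move=> p0 q0; have [->//|pq] := eqVneq p q; have qp : 0 < q / p by rewrite divr_gt0.
have qp1 : q / p != 1.
  by apply: contra pq => /eqP /divr1_eq ->.
have := ln_lt_sub1 qp qp1; rewrite ln_div ?posrE // => h.
have : p * (ln q - ln p) < p * (q / p - 1) by rewrite ltr_pM2l.
have -> : p * (q / p - 1) = q - p by field; rewrite gt_eqF.
lra.
Qed.

(** The function [G s] has the sums of the last hypothesis as derivative, so it is nondecreasing by
    the mean value theorem. It is bounded above by a multiple of [1 / s], because [\sum_i a i = 0]
    permits subtracting [ln s] from each logarithm. Hence [G 0 <= 0]. *)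
Lemma log_sum_le0 (I : finType) (a t : I -> R) :
  (forall i, 0 < t i) -> \sum_i a i = 0 ->
  (forall s : R, 0 < s -> 0 <= \sum_i a i / (t i + s)) -> \sum_i a i * ln (t i) <= 0.
Proof.
move=> t0 a0 ge0; pose G s := \sum_i a i * ln (t i + s).
have dG (s : R) : 0 <= s -> is_derive s 1 G (\sum_i a i / (t i + s)).
  move=> s0; rewrite /G.
  have -> : (fun s => \sum_i a i * ln (t i + s)) = \sum_i (fun s => a i * ln (t i + s)).
    by apply/funext => x; rewrite fct_sumE.
  apply: (big_ind2 (fun f df => is_derive s (1 : R) (f : R -> R) df)) => [|f df f' df' *|i _].
  - exact: is_derive_cst.
  - exact: is_deriveD.
  have ts : 0 < t i + s by have := t0 i; lra.
  have h1 : is_derive s (1 : R) (fun x : R => t i + x) 1.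
    rewrite -[X in is_derive _ _ _ X]add0r.
    exact: (@is_deriveD _ _ _ (cst (t i)) id).
  have h2 := @is_derive1_comp _ (@ln R) (fun x => t i + x) s _ _ (is_derive1_ln ts) h1.
  rewrite mulr1 in h2.
  exact: (@is_deriveZ _ _ _ (fun x => ln (t i + x)) (a i) s 1 _ h2).
have G0s (s : R) : 0 < s -> G 0 <= G s.
  move=> s0; have [||c] := @MVT R G (fun s => \sum_i a i / (t i + s)) 0 s s0.
  - by move=> x; rewrite in_itv /= => /andP[x0 _]; apply: dG; exact: ltW.
  - apply: derivable_within_continuous => x; rewrite in_itv /= => /andP[x0 _].
    by have [] := dG x x0.
  rewrite in_itv /= => /andP[c0 _] e; rewrite -subr_ge0 e mulr_ge0 ?ge0 //; lra.
have Gs (s : R) : 0 < s -> G s <= (\sum_i `|a i| * t i) / s.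
  move=> s0; have -> : G s = \sum_i a i * (ln (t i + s) - ln s).
    under [RHS]eq_bigr do rewrite mulrBr.
    by rewrite sumrB -big_distrl /= a0 mul0r subr0.
  rewrite big_distrl /=; apply: ler_sum => i _.
  rewrite -mulrA; apply: le_trans (ler_norm _) _; rewrite normrM ler_wpM2l //.
  have ti := t0 i.
  rewrite -ln_div ?posrE //; last by lra.
  rewrite mulrDl mulfV ?gt_eqF // addrC ger0_norm; last first.
    by apply: ln_ge0; rewrite lerDl divr_ge0 // ltW.
  by apply: le_ln1Dx; apply: lt_trans (divr_gt0 ti s0); lra.
have -> : \sum_i a i * ln (t i) = G 0 by apply: eq_bigr => i _; rewrite addr0.
rewrite leNgt; apply/negP => G0.
set c := \sum_i `|a i| * t i in Gs.
have c0 : 0 <= c by apply: sumr_ge0 => i _; rewrite mulr_ge0 // ltW.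
(* At this [s] the two bounds give [G 0 <= c / (c + 1) * G 0], impossible for positive [G 0]. *)
have s0 : 0 < (c + 1) / G 0 by rewrite divr_gt0 //; lra.
have := le_trans (G0s _ s0) (Gs _ s0).
rewrite invf_div mulrA ler_pdivlMr; last by lra.
rewrite mulrC ler_pM2r //; lra.
Qed.

End RealLemmas.

(** * Relative entropy *)

Section RelativeEntropy.
Variable R : realType.
Local Notation C := R[i].

(* [cross rho q F] is [- tr (rho log sigma)] for [sigma] with eigenvalues [q] and
   eigenvectors [F], provided [F] spans the support of [rho]. *)
Definition cross (T J : finType) (rho : T -> T -> C) (q : J -> R) (F : T -> J -> C) : R :=
  - \sum_j ln (q j) * complex.Re ((adj F ** (rho ** F)) j j).

Lemma gram_diag (T U : finType) (M : T -> U -> C) t :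
  gram M t t = (\sum_u nsq (M t u))%:C%C.
Proof. by rewrite /gram /fmul /adj rmorph_sum; apply: eq_bigr => u _; rewrite /= nsqE. Qed.

Lemma conj_gram (T U J : finType) (M : T -> U -> C) (F : T -> J -> C) :
  adj F ** (gram M ** F) = gram (adj F ** M).
Proof. by rewrite /gram adjM adjK !fmulA. Qed.

Lemma cross_gram (T U J : finType) (M : T -> U -> C) (q : J -> R) (F : T -> J -> C) :
  cross (gram M) q F = - \sum_j ln (q j) * \sum_u nsq ((adj F ** M) j u).
Proof.
by rewrite /cross; congr (- _); apply: eq_bigr => j _; rewrite conj_gram gram_diag.
Qed.

Lemma sum_unit (V : nmodType) (f : unit -> V) : \sum_x f x = f tt.
Proof. by rewrite (bigD1 tt) //= big1 ?addr0 //; case. Qed.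

Lemma col_bessel (T' K' U' : finType) (G : T' -> K' -> C) (X : T' -> U' -> C) x :
  adj G ** G = @fid R K' -> \sum_k nsq ((adj G ** X) k x) <= \sum_t nsq (X t x).
Proof.
move=> GG; have := @bessel _ _ _ unit G (fun t _ => X t x) GG; rewrite /fnsq.
rewrite (eq_bigr (fun k => nsq ((adj G ** X) k x))); last first.
  by move=> k _; rewrite sum_unit.
by rewrite [leRHS](eq_bigr (fun t => nsq (X t x))) // => t _; rewrite sum_unit.
Qed.

Lemma nsqJ (z : C) : nsq z^* = nsq z.
Proof. by apply: complexI; rewrite !nsqE conjCK mulrC. Qed.

Section TwoStates.
Variables (T K J : finType) (rho sigma : T -> T -> C).
Variables (p : K -> R) (E : T -> K -> C) (q : J -> R) (F : T -> J -> C).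
Hypothesis drho : sdec rho p E.
Hypothesis dsigma : sdec sigma q F.
Hypothesis FE : F ** (adj F ** E) = E.

Let u := adj F ** E.
Let p_gt0 := sdec_gt0 drho.
Let q_gt0 := sdec_gt0 dsigma.
Let EE := sdec_on drho.
Let FF := sdec_on dsigma.

Lemma overlap_col k : \sum_j nsq (u j k) = 1.
Proof. exact: support_col EE FE k. Qed.

(** Only an inequality, unlike for columns: the support of [sigma] may be larger than that of
    [rho]. *)
Lemma overlap_row j : \sum_k nsq (u j k) <= 1.
Proof.
have e k : nsq (u j k) = nsq ((adj E ** F) k j).
  by rewrite -nsqJ; congr nsq; rewrite -/(adj u k j) /u adjM adjK.
under eq_bigr do rewrite e.
apply: le_trans (col_bessel _ _ EE) _.
have : (adj F ** F) j j = 1 by rewrite FF /fid eqxx.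
by rewrite col_nsq => /complexI ->.
Qed.

Lemma cross_overlap : cross rho q F = - \sum_j \sum_k nsq (u j k) * (p k * ln (q j)).
Proof.
rewrite /cross; congr (- _); apply: eq_bigr => j _.
have -> : adj F ** (rho ** F) = u ** (dg p ** adj u).
  by rewrite (sdec_eq drho) /u adjM adjK !fmulA.
rewrite fmul_dgl /fmul Re_sum big_distrr /=; apply: eq_bigr => k _.
rewrite /adj mulrCA -nsqE -rmorphM /=; ring.
Qed.

Lemma Ent_overlap : Ent p = - \sum_j \sum_k nsq (u j k) * (p k * ln (p k)).
Proof.
rewrite exchange_big /Ent; congr (- _); apply: eq_bigr => k _.
by rewrite -big_distrl /= overlap_col mul1r.
Qed.

(** The ratios [q j / p k] are eigenvalues of the relative modular operator. In this form the
    relative entropy is a weighted sum of logarithms, to which [log_sum_le0] can be applied. *)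
Lemma relent_overlap :
  cross rho q F - Ent p = - \sum_j \sum_k nsq (u j k) * p k * ln (q j / p k).
Proof.
rewrite cross_overlap Ent_overlap opprK addrC -opprB; congr (- _).
rewrite -sumrB; apply: eq_bigr => j _; rewrite -sumrB; apply: eq_bigr => k _.
rewrite ln_div ?posrE //; ring.
Qed.

Let d j k := nsq (u j k) * (p k * (ln (p k) - ln (q j)) - (p k - q j)).

Lemma klein_term_ge0 j k : 0 <= d j k.
Proof. by rewrite mulr_ge0 ?nsq_ge0 // subr_ge0 klein_scalar. Qed.

(** The relative entropy in three parts: the scalar Klein gaps, the difference of traces, and the
    weight of [sigma] outside the support of [rho]. The equality case is read off from each part
    separately. *)
Lemma klein_gap : cross rho q F - Ent p =
  (\sum_j \sum_k d j k) + (\sum_k p k - \sum_j q j) + \sum_j q j * (1 - \sum_k nsq (u j k)).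
Proof.
rewrite cross_overlap Ent_overlap.
have e : \sum_k p k = \sum_j \sum_k nsq (u j k) * p k.
  rewrite exchange_big; apply: eq_bigr => k _.
  by rewrite -big_distrl /= overlap_col mul1r.
have e1 : \sum_j q j * (1 - \sum_k nsq (u j k)) =
    \sum_j q j - \sum_j \sum_k nsq (u j k) * q j.
  rewrite -sumrB; apply: eq_bigr => j _; rewrite -big_distrl /=; ring.
have e2 : \sum_j \sum_k d j k = \sum_j \sum_k nsq (u j k) * (p k * ln (p k))
    - \sum_j \sum_k nsq (u j k) * (p k * ln (q j))
    - \sum_j \sum_k nsq (u j k) * p k + \sum_j \sum_k nsq (u j k) * q j.
  rewrite -!sumrB -big_split /=; apply: eq_bigr => j _.
  rewrite -!sumrB -big_split /=; apply: eq_bigr => k _; rewrite /d; ring.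
rewrite e1 e2 e; ring.
Qed.

Lemma klein : \sum_j q j <= \sum_k p k -> Ent p <= cross rho q F.
Proof.
move=> qp; rewrite -subr_ge0 klein_gap; apply: addr_ge0; first apply: addr_ge0; rewrite ?subr_ge0 //.
  by apply: sumr_ge0 => j _; apply: sumr_ge0 => k _; exact: klein_term_ge0.
by apply: sumr_ge0 => j _; rewrite mulr_ge0 ?subr_ge0 ?overlap_row ?(ltW (q_gt0 j)).
Qed.

(** All three parts of [klein_gap] vanish. Full row sums give the reverse inclusion of supports, and
    the scalar equality case makes [u] intertwine [p] and [q]. *)
Lemma klein_eq : \sum_j q j <= \sum_k p k -> cross rho q F <= Ent p -> rho = sigma.
Proof.
move=> qp le0; rewrite -subr_le0 klein_gap in le0.
have s1 : 0 <= \sum_j \sum_k d j k.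
  by apply: sumr_ge0 => j _; apply: sumr_ge0 => k _; exact: klein_term_ge0.
have q1 j : 0 <= q j * (1 - \sum_k nsq (u j k)).
  by rewrite mulr_ge0 ?subr_ge0 ?overlap_row ?(ltW (q_gt0 j)).
have s3 : 0 <= \sum_j q j * (1 - \sum_k nsq (u j k)) by apply: sumr_ge0.
rewrite -subr_ge0 in qp.
have d0 j k : d j k = 0.
  have /eqP : \sum_j \sum_k d j k = 0 by lra.
  rewrite psumr_eq0; last by move=> i _; apply: sumr_ge0 => *; exact: klein_term_ge0.
  move=> /allP /(_ j (mem_index_enum j)) /=; rewrite psumr_eq0; last by move=> *; exact: klein_term_ge0.
  by move=> /allP /(_ k (mem_index_enum k)) /= /eqP.
have row1 j : \sum_k nsq (u j k) = 1.
  have /eqP : \sum_j q j * (1 - \sum_k nsq (u j k)) = 0 by lra.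
  rewrite psumr_eq0 //; move=> /allP /(_ j (mem_index_enum j)) /=.
  by rewrite mulf_eq0 gt_eqF //= subr_eq0 => /eqP.
have EF : E ** (adj E ** F) = F.
  apply: bessel_eq => //; transitivity (\sum_(j : J) (1 : R)).
    rewrite /fnsq exchange_big; apply: eq_bigr => j _; rewrite -[RHS](row1 j).
    apply: eq_bigr => k _; apply: complexI; rewrite !nsqE.
    have -> : (adj E ** F) k j = adj u k j by rewrite /u adjM adjK.
    by rewrite /adj conjCK mulrC.
  rewrite /fnsq exchange_big; apply: eq_bigr => j _; apply: complexI.
  by rewrite -col_nsq FF /fid eqxx.
have uq : u ** dg p = dg q ** u.
  rewrite fmul_dgl fmul_dgr; apply: fext => j k; rewrite mulrC.
  have /eqP := d0 j k; rewrite mulf_eq0 subr_eq0 => /orP[/eqP /nsq_eq0 ->|/eqP e].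
    by rewrite !mulr0.
  by rewrite (klein_scalar_eq (p_gt0 k) (q_gt0 j) e).
rewrite (sdec_eq drho) -{1}FE -/u -fmulA (fmulA u) uq -fmulA (sdec_eq dsigma).
by congr (_ ** (_ ** _)); rewrite -[in RHS]EF !adjM adjK.
Qed.

(* Its supremum over [Z] is the [s]-derivative of [\sum_jk |u j k|^2 p_k ln (q_j / p_k + s)];
   testing only [Z (x) 1] shows that this decreases under partial traces. *)
Definition varobj (s : R) (Z : T -> T -> C) : R :=
  2 * complex.Re (ftr (rho ** adj Z)) - complex.Re (ftr (sigma ** (Z ** adj Z)))
  - s * complex.Re (ftr (rho ** (adj Z ** Z))).

Lemma ftr_sdec (X : T -> T -> C) (K' : finType) (r : K' -> R) (G : T -> K' -> C) tau :
  sdec tau r G -> ftr (tau ** X) = \sum_k (r k)%:C%C * (adj G ** (X ** G)) k k.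
Proof.
move=> d1; rewrite (sdec_eq d1) -!fmulA ftrC -!fmulA fmul_dgl.
by apply: eq_bigr.
Qed.

Lemma varobjE s Z : varobj s Z =
  \sum_k p k * (2 * complex.Re ((adj E ** (adj Z ** E)) k k))
  - \sum_j q j * (\sum_t nsq ((adj F ** Z) j t))
  - s * \sum_k p k * (\sum_t nsq ((Z ** E) t k)).
Proof.
rewrite /varobj !(ftr_sdec _ drho) (ftr_sdec _ dsigma) !Re_sum big_distrr /=.
congr (_ - _ - s * _); apply: eq_bigr => i _.
- by rewrite ReZ mulrCA.
- by rewrite ReZ -/(gram Z) conj_gram gram_diag.
have -> : adj E ** (adj Z ** Z ** E) = adj (Z ** E) ** (Z ** E) by rewrite adjM !fmulA.
by rewrite ReZ col_nsq.
Qed.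

Let bound s := \sum_j \sum_k nsq (u j k) * p k / (q j / p k + s).

(** Completing the square in [z]; the square vanishes at [z = p k / (q j + s * p k) * u j k], the
    value used in [varobj_attained]. *)
Lemma varobj_scalar (s : R) j k (z : C) : 0 < s ->
  p k * (2 * complex.Re (z^* * u j k)) - q j * nsq z - s * (p k * nsq z) <=
  nsq (u j k) * p k / (q j / p k + s).
Proof.
move=> s0; case: z => a b; case: (u j k) => c e; rewrite /nsq /=.
have pk := p_gt0 k; have qj := q_gt0 j.
have D0 : 0 < q j + s * p k by rewrite addr_gt0 ?mulr_gt0.
have -> : (c ^+ 2 + e ^+ 2) * p k / (q j / p k + s) =
    (c ^+ 2 + e ^+ 2) * p k ^+ 2 / (q j + s * p k).
  by field; rewrite !gt_eqF.
rewrite ler_pdivlMr // -subr_ge0.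
have -> : (c ^+ 2 + e ^+ 2) * p k ^+ 2 -
  (p k * (2 * (a * c - - b * e)) - q j * (a ^+ 2 + b ^+ 2) - s * (p k * (a ^+ 2 + b ^+ 2))) *
  (q j + s * p k) = ((q j + s * p k) * a - p k * c) ^+ 2 + ((q j + s * p k) * b - p k * e) ^+ 2.
  by ring.
by rewrite addr_ge0 ?sqr_ge0.
Qed.

(** In the bases [E] and [F] the linear term is exact because [E] lies in the span of [F], while
    components of [Z] outside these spans only enlarge the two subtracted squares. What remains is
    bounded entry by entry. *)
Lemma varobj_le s Z : 0 < s -> varobj s Z <= bound s.
Proof.
move=> s0; pose z := adj F ** (Z ** E).
apply: le_trans (_ : \sum_j \sum_k (p k * (2 * complex.Re ((z j k)^* * u j k)) - q j * nsq (z j k)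
   - s * (p k * nsq (z j k))) <= _); last first.
  by apply: ler_sum => j _; apply: ler_sum => k _; exact: varobj_scalar.
rewrite varobjE; under [leRHS]eq_bigr do rewrite !sumrB.
rewrite !sumrB !lerB //.
- rewrite exchange_big /=; apply: ler_sum => k _; rewrite -big_distrr /= ler_pM2l //.
  rewrite -big_distrr /= ler_pM2l // -Re_sum.
  rewrite le_eqVlt; apply/orP; left; apply/eqP; congr complex.Re.
  have -> : adj E ** (adj Z ** E) = adj z ** u.
    by rewrite -{2}FE /z /u !adjM adjK !fmulA.
  by [].
- apply: ler_sum => j _; rewrite -big_distrr /= ler_pM2l //.
  have e1 : \sum_k nsq (z j k) = \sum_k nsq ((adj E ** adj (adj F ** Z)) k j).
    apply: eq_bigr => k _; rewrite (_ : adj E ** adj (adj F ** Z) = adj z) ?nsqJ //.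
    by rewrite /z !adjM !fmulA.
  have e2 : \sum_t nsq ((adj F ** Z) j t) = \sum_t nsq (adj (adj F ** Z) t j).
    by apply: eq_bigr => t _; rewrite nsqJ.
  by rewrite e1 e2; exact: col_bessel EE.
rewrite exchange_big /= big_distrr /=; apply: ler_sum => k _.
rewrite -!big_distrr /= ler_pM2l // ler_pM2l //.
exact: col_bessel FF.
Qed.

(** The scalar maximisers are assembled into an operator from the span of [E] to that of [F], for
    which the Bessel steps of [varobj_le] lose nothing. *)
Lemma varobj_attained s : 0 < s -> exists Z, varobj s Z = bound s.
Proof.
move=> s0; pose z j k : C := (p k / (q j + s * p k))%:C%C * u j k.
pose Z := F ** (z ** adj E); exists Z; rewrite varobjE /bound.
have ZE : Z ** E = F ** z by rewrite /Z -!fmulA EE fmul1r.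
have FZ : adj F ** Z = z ** adj E by rewrite /Z fmulA FF fmul1l.
have e1 : adj E ** (adj Z ** E) = adj z ** u.
  by rewrite fmulA -adjM ZE adjM -fmulA.
have e2 j : \sum_t nsq ((adj F ** Z) j t) = \sum_k nsq (z j k).
  by apply: complexI; rewrite -!gram_diag FZ /gram adjM adjK -fmulA (fmulA (adj E)) EE fmul1l.
have e3 k : \sum_t nsq ((Z ** E) t k) = \sum_j nsq (z j k).
  by apply: complexI; rewrite -!col_nsq ZE adjM -fmulA (fmulA (adj F)) FF fmul1l.
rewrite e1; under [X in _ - X - _]eq_bigr do rewrite e2 big_distrr /=.
under [X in _ - s * X]eq_bigr do rewrite e3 big_distrr /=.
rewrite [X in _ - s * X]exchange_big big_distrr /=.
have -> : \sum_k p k * (2 * complex.Re ((adj z ** u) k k)) =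
    \sum_j \sum_k p k * (2 * complex.Re ((z j k)^* * u j k)).
  rewrite exchange_big; apply: eq_bigr => k _.
  by rewrite -!big_distrr /= /fmul Re_sum.
rewrite -!sumrB; apply: eq_bigr => j _; rewrite big_distrr -!sumrB; apply: eq_bigr => k _ /=.
have pk := p_gt0 k; have qj := q_gt0 j.
have D0 : 0 < q j + s * p k by rewrite addr_gt0 ?mulr_gt0.
rewrite /z; case: (u j k) => c e; rewrite /nsq /=.
by field; rewrite !gt_eqF.
Qed.

End TwoStates.

End RelativeEntropy.

(** * Strong subadditivity *)

Section Monotonicity.
Variable R : realType.
Local Notation C := R[i].

Lemma sum_pair (A : nmodType) (T V : finType) (F : T * V -> A) :
  \sum_x F x = \sum_t \sum_v F (t, v).
Proof. by rewrite pair_bigA; apply: eq_bigr => -[]. Qed.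

Lemma ftr_ptrace (T V : finType) (rho : T * V -> T * V -> C) (X : T -> T -> C) :
  ftr (rho ** kron X (@fid R V)) = ftr ((fun t t' => \sum_v rho (t, v) (t', v)) ** X).
Proof.
rewrite /ftr /fmul sum_pair.
apply: eq_bigr => t _.
transitivity (\sum_v \sum_t' rho (t, v) (t', v) * X t' t).
  apply: eq_bigr => v _.
  rewrite sum_pair; apply: eq_bigr => t' _; rewrite (bigD1 v) //= big1 ?addr0 => [|v' ne].
    by rewrite /kron /fid /= eqxx mulr1.
  by rewrite /kron /fid /= (negPf ne) !mulr0.
by rewrite exchange_big; apply: eq_bigr => t' _; rewrite big_distrl.
Qed.

(** Both relative entropies are merged into one signed sum over the disjoint union of their index
    sets. Its total weight is zero because the traces of [rho] and [rho'] agree, and it has the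
    right sign at each [s] because the optimal [Z] of the reduced pair, tensored with the identity,
    is a test operator for the full pair. *)
Lemma relent_mono (T V K J K' J' : finType) (rho sigma : T * V -> T * V -> C)
    (rho' sigma' : T -> T -> C) (p : K -> R) E (q : J -> R) F (p' : K' -> R) E' (q' : J' -> R) F' :
  rho' = (fun t t' => \sum_v rho (t, v) (t', v)) ->
  sigma' = (fun t t' => \sum_v sigma (t, v) (t', v)) ->
  sdec rho p E -> sdec sigma q F -> sdec rho' p' E' -> sdec sigma' q' F' ->
  F ** (adj F ** E) = E -> F' ** (adj F' ** E') = E' ->
  cross rho' q' F' - Ent p' <= cross rho q F - Ent p.
Proof.
move=> er es dr ds dr' ds' FE FE'.
have p0 := sdec_gt0 dr; have q0 := sdec_gt0 ds.
have p0' := sdec_gt0 dr'; have q0' := sdec_gt0 ds'.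
rewrite (relent_overlap dr ds FE) (relent_overlap dr' ds' FE').
set u := adj F ** E; set u' := adj F' ** E'.
rewrite lerN2 -subr_le0.
pose a (x : (J * K) + (J' * K')) := match x with
  | inl y => nsq (u y.1 y.2) * p y.2 | inr y => - (nsq (u' y.1 y.2) * p' y.2) end.
pose t (x : (J * K) + (J' * K')) := match x with
  | inl y => q y.1 / p y.2 | inr y => q' y.1 / p' y.2 end.
have sumE (f : R -> R) : \sum_x a x * f (t x) =
    \sum_j \sum_k nsq (u j k) * p k * f (q j / p k) -
    \sum_j \sum_k nsq (u' j k) * p' k * f (q' j / p' k).
  rewrite big_sumType /= !pair_bigA /=; congr (_ + _).
  by rewrite -sumrN; apply: eq_bigr => x _; rewrite mulNr.
rewrite -(sumE (@ln R)); apply: log_sum_le0.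
- by case=> x; rewrite divr_gt0.
- transitivity (\sum_x a x * (fun=> 1) (t x)); first by apply: eq_bigr => x _; rewrite mulr1.
  rewrite (sumE (fun=> 1)) /=; apply/eqP; rewrite subr_eq0; apply/eqP.
  transitivity (\sum_k p k).
    rewrite exchange_big; apply: eq_bigr => k _.
    by under eq_bigr do rewrite mulr1; rewrite -big_distrl /= (overlap_col dr FE) mul1r.
  transitivity (\sum_k p' k); last first.
    rewrite exchange_big; apply: eq_bigr => k _.
    by under eq_bigr do rewrite mulr1; rewrite -big_distrl /= (overlap_col dr' FE') mul1r.
  apply: complexI; rewrite -(sdec_trace dr) -(sdec_trace dr') er.
  by rewrite /ftr pair_bigA; apply: eq_bigr => -[].
move=> s s0; rewrite (sumE (fun x => (x + s)^-1)) subr_ge0.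
have [Z eZ] := varobj_attained dr' ds' s0; rewrite -/u' in eZ; rewrite -eZ.
have <- : varobj rho sigma s (kron Z (@fid R V)) = varobj rho' sigma' s Z.
  by rewrite /varobj adj_kron adj_fid !kron_mul fmul1l !ftr_ptrace -er -es.
exact: varobj_le dr ds FE s _ s0.
Qed.

Lemma gram_ptrace (T V U : finType) (M : T -> V * U -> C) :
  gram M = fun t t' => \sum_v gram (fun (y : T * V) u => M y.1 (y.2, u)) (t, v) (t', v).
Proof.
apply: fext => t t'; rewrite /gram /fmul pair_bigA /=.
by apply: eq_bigr => -[].
Qed.

Lemma sdec_fid (T : finType) : sdec (@fid R T) (fun _ => 1) (@fid R T).
Proof.
split=> //; first by rewrite adj_fid fmul1l.
by rewrite dg1 adj_fid !fmul1l.
Qed.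

Lemma kron_support_r (X B K U : finType) (M : X * B -> U -> C) (G : B -> K -> C) :
  G ** (adj G ** (fun b (y : X * U) => M (y.1, b) y.2)) = (fun b (y : X * U) => M (y.1, b) y.2) ->
  kron (@fid R X) G ** (adj (kron (@fid R X) G) ** M) = M.
Proof.
move=> GM; rewrite adj_kron adj_fid fmulA kron_mul fmul1l; apply: fext => -[x b] l.
have := congr1 (fun f => f b (x, l)) GM; rewrite fmulA /= => <-.
rewrite [LHS]sum_pair.
rewrite (bigD1 x) //= [X in _ + X]big1 ?addr0 => [|x' ne].
  by apply: eq_bigr => b' _; rewrite /kron /fid /= eqxx mul1r.
by apply: big1 => b' _; rewrite /kron /fid /= eq_sym (negPf ne) !mul0r.
Qed.

Lemma adj_kron_fidE (X B K U : finType) (M : X * B -> U -> C) (G : B -> K -> C) x k l :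
  (adj (kron (@fid R X) G) ** M) (x, k) l = (adj G ** (fun b (y : X * U) => M (y.1, b) y.2)) k (x, l).
Proof.
rewrite adj_kron adj_fid [LHS]sum_pair.
rewrite (bigD1 x) //= [X in _ + X]big1 ?addr0 => [|x' ne].
  by apply: eq_bigr => b' _; rewrite /kron /fid /= eqxx mul1r.
by apply: big1 => b' _; rewrite /kron /fid /= eq_sym (negPf ne) !mul0r.
Qed.

Lemma sdec_row_nsq (T U K : finType) (M : T -> U -> C) (p : K -> R) (E : T -> K -> C) k :
  sdec (gram M) p E -> \sum_u nsq ((adj E ** M) k u) = p k.
Proof.
move=> dE; apply: complexI; rewrite -gram_diag -conj_gram (sdec_mul dE) fmulA (sdec_on dE).
by rewrite fmul1l /dg eqxx.
Qed.

(* [- tr (rho_XB log (1_X (x) rho_B)) = S(B)]. *)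
Lemma cross_kron_fid (X B K U : finType) (M : X * B -> U -> C) (q : K -> R) (G : B -> K -> C) :
  sdec (gram (fun b (y : X * U) => M (y.1, b) y.2)) q G ->
  cross (gram M) (fun y => 1 * q y.2) (kron (@fid R X) G) = Ent q.
Proof.
move=> dG; rewrite cross_gram /Ent; congr (- _).
transitivity (\sum_x \sum_k ln (q k) * \sum_u nsq ((adj (kron (@fid R X) G) ** M) (x, k) u)).
  by rewrite pair_bigA; apply: eq_bigr => -[x k] _; rewrite mul1r.
rewrite exchange_big; apply: eq_bigr => k _; rewrite -big_distrr /= mulrC; congr (_ * _).
rewrite -(sdec_row_nsq k dG).
under eq_bigr do under eq_bigr do rewrite adj_kron_fidE.
by rewrite pair_bigA; apply: eq_bigr => -[].
Qed.

Lemma fmul_reindexr (T T' U V : finType) (h : T' -> T) (f : U -> T -> C) (g : T -> V -> C) :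
  bijective h -> (fun u t => f u (h t)) ** (fun t => g (h t)) = f ** g.
Proof.
move=> bh; apply: fext => u v; rewrite /fmul [RHS](reindex h) //; exact: onW_bij.
Qed.

(** Monotonicity of the relative entropy of rho_XYZ and 1_X (x) rho_YZ under the trace over [Z]. By
    [cross_kron_fid] it reads S(Y) - S(XY) <= S(YZ) - S(XYZ). *)
Theorem strong_subadditivity (X Y Z L : finType) (phi : X -> Y -> Z -> L -> C) :
  vN (fun y (w : X * (Z * L)) => phi w.1 y w.2.1 w.2.2) +
  vN (fun (w : X * (Y * Z)) l => phi w.1 w.2.1 w.2.2 l) <=
  vN (fun (w : X * Y) (w' : Z * L) => phi w.1 w.2 w'.1 w'.2) +
  vN (fun (w : Y * Z) (w' : X * L) => phi w'.1 w.1 w.2 w'.2).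
Proof.
set MY := (fun y _ => _); set MXYZ := (fun w l => _) ; set MXY := (fun w w' => phi w.1 w.2 _ _).
set MYZ := (fun w w' => phi w'.1 _ _ _).
(* Reassociation puts [Z] last, the factor that [relent_mono] traces out. *)
pose h (w : (X * Y) * Z) : X * (Y * Z) := (w.1.1, (w.1.2, w.2)).
have bh : bijective h by exists (fun w => ((w.1, w.2.1), w.2.2)) => [[[]]|[? []]].
pose M w l := MXYZ (h w) l.
have eM : vN MXYZ = vN M by apply/esym; apply: (@vN_bij _ _ _ _ _ h id) => //; exists id.
have [K [p [E [dE sE]]]] := sdec_exists M.
have [K' [p' [E' [dE' sE']]]] := sdec_exists MXY.
have [J [q [G [dG sG]]]] := sdec_exists MYZ.
have [J' [q' [G' [dG' sG']]]] := sdec_exists MY.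
have dF := sdec_reindex bh (sdec_kron (sdec_fid X) dG).
have dF' := sdec_kron (sdec_fid X) dG'.
have GM := kron_support_r (M := MXYZ) (gram_support dG).
have hE : adj (fun w => kron (@fid R X) G (h w)) ** M = adj (kron (@fid R X) G) ** MXYZ.
  exact: (fmul_reindexr (adj (kron (@fid R X) G)) MXYZ bh).
have FM : (fun w => kron (@fid R X) G (h w)) ** (adj (fun w => kron (@fid R X) G (h w)) ** M) = M.
  rewrite hE; apply: fext => w l; have := congr1 (fun f => f (h w) l) GM; exact.
have dG2 : sdec (gram (fun b (y : X * (Z * L)) => MXY (y.1, b) y.2)) q' G' by exact: dG'.
have GM' := kron_support_r (M := MXY) (gram_support dG2).
have FE := sdec_support dE FM; have FE' := sdec_support dE' GM'.
have c : cross (gram M) (fun y : X * J => 1 * q y.2) (fun w => kron (@fid R X) G (h w)) = Ent q.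
  rewrite -[RHS](cross_kron_fid (M := MXYZ) dG) !cross_gram; congr (- _).
  by rewrite hE.
have c' : cross (gram MXY) (fun y : X * J' => 1 * q' y.2) (kron (@fid R X) G') = Ent q'.
  exact: cross_kron_fid dG2.
have := relent_mono _ _ dE dF dE' dF' FE FE'.
rewrite c c' eM sE sE' sG sG' => H.
suff : Ent q' - Ent p' <= Ent q - Ent p by lra.
apply: H.
  by rewrite gram_ptrace.
have eY : gram MY = fun y y' => \sum_z gram MYZ (y, z) (y', z).
  apply: fext => y y'; rewrite /gram /fmul sum_pair.
  under eq_bigr do rewrite sum_pair; rewrite exchange_big; apply: eq_bigr => z _.
  by rewrite [RHS]sum_pair.
by apply: fext => -[x y] [x' y']; rewrite /kron eY /= big_distrr.
Qed.

End Monotonicity.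

(** * Subadditivity and its equality case *)

Section Subadditivity.
Variable R : realType.
Local Notation C := R[i].

Lemma support_fnsq (T K U : finType) (F : T -> K -> C) (M : T -> U -> C) :
  adj F ** F = @fid R K -> F ** (adj F ** M) = M -> fnsq (adj F ** M) = fnsq M.
Proof.
move=> FF FM; apply/eqP; rewrite eq_sym -subr_eq0 -fnsq_proj // FM; apply/eqP.
apply: big1 => t _; apply: big1 => u _.
by rewrite /fsub subrr /nsq /= expr0n /= addr0.
Qed.

Section TwoParties.
Variables X Y L : finType.
Implicit Type M : X * Y -> L -> C.

Definition partl M : X -> Y * L -> C := fun x w => M (x, w.1) w.2.
Definition partr M : Y -> X * L -> C := fun y w => M (w.1, y) w.2.

Lemma adj_kronE (J K : finType) M (F : X -> J -> C) (G : Y -> K -> C) j k l :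
  (adj (kron F G) ** M) (j, k) l = (adj G ** (fun y l => (adj F ** partl M) j (y, l))) k l.
Proof.
rewrite adj_kron [LHS]sum_pair exchange_big; apply: eq_bigr => y _.
by rewrite [RHS]big_distrr; apply: eq_bigr => x _; rewrite /kron /= mulrA (mulrC (adj G _ _)).
Qed.

(** The diagonal of rho_XY in the product of the two eigenbases has the spectrum of rho_X as its
    marginal; summing over [k] loses nothing since [G] spans the support of rho_Y. *)
Lemma kron_marginal (J K : finType) M (q : J -> R) F (r : K -> R) G j :
  sdec (gram (partl M)) q F -> sdec (gram (partr M)) r G ->
  \sum_k \sum_l nsq ((adj (kron F G) ** M) (j, k) l) = q j.
Proof.
move=> dF dG; rewrite -(sdec_row_nsq j dF) sum_pair.
set A := fun y l => (adj F ** partl M) j (y, l).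
rewrite -/(fnsq A) -(support_fnsq (sdec_on dG) (M := A)); last first.
  (* Contracting [X] with an eigenvector acts on the right of [partr M], so the columns of [A] stay
     in the span of [G]. *)
  have -> : A = partr M ** (fun w l => if w.2 == l then (F w.1 j)^* else 0).
    apply: fext => y l; rewrite [RHS]sum_pair; apply: eq_bigr => x _.
    rewrite (bigD1 l) //= eqxx big1 ?addr0 => [|l' /negPf ->]; last by rewrite mulr0.
    exact: mulrC.
  by rewrite !fmulA -(fmulA G) (gram_support dG).
by apply: eq_bigr => k _; apply: eq_bigr => l _; rewrite adj_kronE.
Qed.

Lemma kron_support (J K : finType) M (q : J -> R) F (r : K -> R) G :
  sdec (gram (partl M)) q F -> sdec (gram (partr M)) r G ->
  kron F G ** (adj (kron F G) ** M) = M.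
Proof.
move=> dF dG; apply: bessel_eq.
  by rewrite adj_kron kron_mul (sdec_on dF) (sdec_on dG) kron_fid.
rewrite /fnsq sum_pair; under eq_bigr do rewrite (kron_marginal _ dF dG).
rewrite (sdec_gram_sum dF) /fnsq sum_pair; apply: eq_bigr => x _.
by rewrite sum_pair.
Qed.

End TwoParties.

Definition flip (X Y L : Type) (M : X * Y -> L -> C) : Y * X -> L -> C :=
  fun w => M (w.2, w.1).

Lemma adj_kron_flip (X Y L J K : finType) (M : X * Y -> L -> C) (F : X -> J -> C)
    (G : Y -> K -> C) j k l :
  (adj (kron F G) ** M) (j, k) l = (adj (kron G F) ** flip M) (k, j) l.
Proof.
rewrite !adj_kron [LHS]sum_pair [RHS]sum_pair exchange_big.
by apply: eq_bigr => y _; apply: eq_bigr => x _; rewrite /kron (mulrC (adj F _ _)).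
Qed.

(** The logarithm of rho_X (x) rho_Y is a sum, and each summand sees only one marginal of rho_XY. *)
Lemma cross_kron (X Y L J K : finType) (M : X * Y -> L -> C) (q : J -> R) F (r : K -> R) G :
  sdec (gram (partl M)) q F -> sdec (gram (partr M)) r G ->
  cross (gram M) (fun w => q w.1 * r w.2) (kron F G) = Ent q + Ent r.
Proof.
move=> dF dG; rewrite cross_gram /Ent -opprD; congr (- _).
have q0 := sdec_gt0 dF; have r0 := sdec_gt0 dG.
pose w j k := \sum_l nsq ((adj (kron F G) ** M) (j, k) l).
transitivity (\sum_j \sum_k (w j k * ln (q j) + w j k * ln (r k))).
  rewrite sum_pair; apply: eq_bigr => j _; apply: eq_bigr => k _ /=.
  rewrite lnM ?posrE // -/(w j k); ring.
under eq_bigr do rewrite big_split /= -big_distrl (kron_marginal _ dF dG) /=.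
rewrite big_split /=; congr (_ + _); rewrite exchange_big /=; apply: eq_bigr => k _.
rewrite -big_distrl /=; congr (_ * _).
rewrite -(kron_marginal (M := flip M) k dG dF); apply: eq_bigr => j _.
by apply: eq_bigr => l _; rewrite adj_kron_flip.
Qed.

Lemma subadditivity_sum (X Y L J K : finType) (M : X * Y -> L -> C) (q : J -> R) F (r : K -> R) G :
  fnsq M = 1 -> sdec (gram (partl M)) q F -> sdec (gram (partr M)) r G ->
  \sum_(w : J * K) q w.1 * r w.2 = 1.
Proof.
move=> M1 dF dG; rewrite sum_pair /=; under eq_bigr do rewrite -big_distrr /=.
rewrite -big_distrl /= (sdec_gram_sum dF) (sdec_gram_sum dG) -[RHS]mulr1 -M1.
congr (_ * _); rewrite /fnsq.
  by rewrite [RHS]sum_pair; apply: eq_bigr => x _; rewrite sum_pair.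
by rewrite [RHS]sum_pair [RHS]exchange_big /=; apply: eq_bigr => y _; rewrite sum_pair.
Qed.

Theorem subadditivity (X Y L : finType) (M : X * Y -> L -> C) : fnsq M = 1 ->
  vN M <= vN (partl M) + vN (partr M).
Proof.
move=> M1; have [I [p [E [dE ->]]]] := sdec_exists M.
have [J [q [F [dF ->]]]] := sdec_exists (partl M).
have [K [r [G [dG ->]]]] := sdec_exists (partr M).
rewrite -(cross_kron dF dG); apply: (klein dE (sdec_kron dF dG)).
  exact: sdec_support dE (kron_support dF dG).
by rewrite (subadditivity_sum M1 dF dG) (sdec_gram_sum dE) M1.
Qed.

Theorem subadditivity_eq (X Y L : finType) (M : X * Y -> L -> C) : fnsq M = 1 ->
  vN (partl M) + vN (partr M) <= vN M -> gram M = kron (gram (partl M)) (gram (partr M)).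
Proof.
move=> M1; have [I [p [E [dE ->]]]] := sdec_exists M.
have [J [q [F [dF ->]]]] := sdec_exists (partl M).
have [K [r [G [dG ->]]]] := sdec_exists (partr M).
rewrite -(cross_kron dF dG); apply: (klein_eq dE (sdec_kron dF dG)).
  exact: sdec_support dE (kron_support dF dG).
by rewrite (subadditivity_sum M1 dF dG) (sdec_gram_sum dE) M1.
Qed.

End Subadditivity.

(** * Isometries between purifications *)

Section Isometries.
Variable R : realType.
Local Notation C := R[i].

Lemma gram_adj (T U : finType) (M : T -> U -> C) : gram (adj M) = adj M ** M.
Proof. by rewrite /gram adjK. Qed.

(* Two families of vectors with the same Gram matrix differ by a partial isometry [y x^*];
   adding the defect [1 - x x^*] in orthogonal coordinates makes it an isometry. *)
Lemma gram_isometry (S T U : finType) (X : T -> U -> C) (Y : S -> U -> C) :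
  adj X ** X = adj Y ** Y ->
  exists W : S + T -> T -> C, adj W ** W = @fid R T /\
    forall s u, (W ** X) s u = if s is inl s then Y s u else 0.
Proof.
move=> XY; have [K [p [E [dE _]]]] := sdec_exists (adj X).
have dE' : sdec (gram (adj Y)) p E by rewrite gram_adj -XY -gram_adj.
have p0 := sdec_gt0 dE; have on := sdec_on dE.
(* Polar decomposition: scaling the columns of [X ** E] by the inverse square roots makes them
   orthonormal, and those of [Y ** E] too, as [X] and [Y] have the same Gram matrix on [U]. *)
pose r k := (Num.sqrt (p k))^-1.
have rp : dg (fun k => r k * r k) ** dg p = @fid R K.
  rewrite dg_mul -dg1; congr dg; apply/funext => k.
  by rewrite /r -invfM -expr2 sqr_sqrtr ?mulVf ?gt_eqF // ltW.
have isoP (V : finType) (Z : V -> U -> C) : sdec (gram (adj Z)) p E ->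
    [/\ adj (Z ** E ** dg r) ** (Z ** E ** dg r) = @fid R K &
        Z ** E ** adj E = Z].
  move=> dZ; split.
    rewrite !adjM adj_dg -!fmulA (fmulA (adj Z)) -gram_adj (fmulA (gram _)) (sdec_mul dZ).
    rewrite -!fmulA (fmulA (adj E)) on fmul1l -rp !dg_mul; congr dg.
    by apply/funext => k; ring.
  by have := congr1 (@adj R _ _) (gram_support dZ); rewrite !adjM !adjK.
have [xx XE] := isoP _ X dE; have [yy YE] := isoP _ Y dE'.
set x := X ** E ** dg r in xx; set y := Y ** E ** dg r in yy.
have zxX (V : finType) (Z : V -> U -> C) : Z ** E ** adj E = Z ->
    Z ** E ** dg r ** adj x ** X = Z.
  move=> ZE; rewrite /x !adjM adj_dg -!fmulA -gram_adj.
  rewrite (sdec_eq dE) (fmulA (adj E)) on fmul1l !fmulA -(fmulA (Z ** E)) dg_mul.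
  by rewrite -(fmulA (Z ** E)) rp fmul1r.
pose D := fsub (@fid R T) (x ** adj x).
exists (fun s => match s with inl s => (y ** adj x) s | inr t => D t end); split.
  have -> : @fid R T = fun t t' => (adj (y ** adj x) ** (y ** adj x)) t t' + (adj D ** D) t t'.
    have -> : adj (y ** adj x) ** (y ** adj x) = x ** adj x.
      by rewrite adjM adjK -fmulA (fmulA (adj y)) yy fmul1l.
    have -> : adj D ** D = D.
      rewrite /D adjB adj_fid adjM adjK fmulBl fmul1l fmulBr fmul1r.
      rewrite -fmulA (fmulA (adj x)) xx fmul1l.
      by apply: fext => t t'; rewrite /fsub subrr subr0.
    by apply: fext => t t'; rewrite /D /fsub addrC subrK.
  by apply: fext => t t'; rewrite /fmul big_sumType.
case=> [s|t] u.
  by rewrite -[in RHS](zxX _ Y YE).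
transitivity ((D ** X) t u) => //.
by rewrite /D fmulBl fmul1l /fsub (zxX _ X XE) subrr.
Qed.

(** When rho_XY is a product, the product of a purification of rho_X and one of rho_Y purifies it as
    well, so [L] maps isometrically into the two purifying systems. Both purifications are copies of
    [M]: [Y * L] purifies [X], and [X * L] purifies [Y]. *)
Lemma decouple (X Y L : finType) (M : X * Y -> L -> C) :
  gram M = kron (gram (partl M)) (gram (partr M)) ->
  exists W : ((Y * L) * (X * L)) + L -> L -> C, adj W ** W = @fid R L /\
    forall s x y, \sum_l W s l * M (x, y) l =
      if s is inl (s1, s2) then M (x, s1.1) s1.2 * M (s2.1, y) s2.2 else 0.
Proof.
move=> e; pose N := kron (trp (partl M)) (trp (partr M)).
have gE (V W : finType) (P : V -> W -> C) w w' : (adj (trp P) ** trp P) w w' = gram P w' w.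
  by apply: eq_bigr => l _; rewrite mulrC.
have [W [WW WM]] : exists W : ((Y * L) * (X * L)) + L -> L -> C, adj W ** W = @fid R L /\
    forall s u, (W ** trp M) s u = if s is inl s then N s u else 0.
  apply: gram_isometry; rewrite /N adj_kron kron_mul; apply: fext => w w'.
  by rewrite gE e /kron !gE.
by exists W; split=> // s x y; have := WM s (x, y); case: s => [[s1 s2]|l].
Qed.

(** A direct sum is not a tensor product, so the extra summand [P] is moved into the second factor,
    with the first factor held at the base point [s0]. *)
Lemma pad_isometry (S T P Q : finType) (s0 : S) (W : (S * T) + P -> Q -> C) :
  adj W ** W = @fid R Q ->
  exists V : S * (T + P) -> Q -> C, adj V ** V = @fid R Q /\
    forall s t q, V (s, t) q = match t with
      inl t => W (inl (s, t)) q | inr p => (s == s0)%:R * W (inr p) q end.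
Proof.
move=> WW; exists (fun x q => match x.2 with
      inl t => W (inl (x.1, t)) q | inr p => (x.1 == s0)%:R * W (inr p) q end); split=> //.
rewrite -WW; apply: fext => q q'; rewrite /fmul sum_pair.
under eq_bigr do rewrite big_sumType /=.
rewrite big_split big_sumType sum_pair /=; congr (_ + _).
rewrite (bigD1 s0) //= [X in _ + X]big1 ?addr0 => [|s /negPf ne].
  by apply: eq_bigr => p _; rewrite /adj /= eqxx !mul1r.
by apply: big1 => p _; rewrite /adj /= ne !mul0r mulr0.
Qed.

End Isometries.

(** * Translation of the definitions *)

Section Translation.
Variable R : realType.
Local Notation C := R[i].

Lemma tens2_bij m n : bijective (fun w : 'I_m * 'I_n => tens2 w.1 w.2).
Proof.
exists (@mxtens_unindex m n) => [[i j]|s]; first exact: mxtens_indexK.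
by rewrite /tens2 -surjective_pairing mxtens_unindexK.
Qed.

Lemma unindex_bij m n : bijective (@mxtens_unindex m n).
Proof. by exists (@mxtens_index m n); [exact: mxtens_unindexK|exact: mxtens_indexK]. Qed.

Lemma tens2K m n (s : 'I_(m * n)) : tens2 (mxtens_unindex s).1 (mxtens_unindex s).2 = s.
Proof. by rewrite /tens2 -surjective_pairing mxtens_unindexK. Qed.

Lemma sum_tens2 (V : nmodType) m n (F : 'I_(m * n) -> V) :
  \sum_s F s = \sum_i \sum_j F (tens2 i j).
Proof.
rewrite (reindex (fun w : 'I_m * 'I_n => tens2 w.1 w.2)); last exact/onW_bij/tens2_bij.
by rewrite sum_pair.
Qed.

Lemma unindex_tens2 m n (i : 'I_m) (j : 'I_n) : mxtens_unindex (tens2 i j) = (i, j).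
Proof. exact: mxtens_indexK. Qed.

Lemma isometryP m n (V : 'M[C]_(m, n)) :
  Defs.isometry V <-> adj (fun i j => V i j) ** (fun i j => V i j) = @fid R 'I_n.
Proof.
split=> [VV|VV].
  apply: fext => i j; have := congr1 (fun A : 'M[C]_n => A i j) VV; rewrite !mxE => e; rewrite /fid -e.
  by apply: eq_bigr => k _; rewrite !mxE.
apply/matrixP => i j; rewrite !mxE; have := congr1 (fun f => f i j) VV; rewrite /fid => <-.
by apply: eq_bigr => k _; rewrite !mxE.
Qed.

Lemma pure_stateP n (v : 'cV[C]_n) : pure_state v <-> \sum_s nsq (v s 0) = 1.
Proof.
have e : (v^t* *m v) 0 0 = (\sum_s nsq (v s 0))%:C%C.
  by rewrite mxE rmorph_sum; apply: eq_bigr => s _; rewrite !mxE /= nsqE mulrC.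
split=> [v1|v1]; first by apply: complexI; rewrite -e v1 mxE eqxx.
by apply/matrixP => i j; rewrite !ord1 e v1 mxE eqxx.
Qed.

Lemma fnsq_tens2 m n (v : 'cV[C]_(m * n)) :
  pure_state v <-> fnsq (fun i j => v (tens2 i j) 0) = 1.
Proof. by rewrite pure_stateP sum_tens2. Qed.

Lemma tens3_apply m n p m' n' p' (A : 'M[C]_(m', m)) (B : 'M[C]_(n', n)) (D : 'M[C]_(p', p))
    (v : 'cV[C]_(m * n * p)) i j k :
  ((A *t B *t D) *m v) (tens3 i j k) 0 =
  \sum_i' \sum_j' \sum_k' A i i' * B j j' * D k k' * v (tens3 i' j' k') 0.
Proof.
rewrite mxE sum_tens2 sum_tens2; apply: eq_bigr => i' _; apply: eq_bigr => j' _.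
by apply: eq_bigr => k' _; rewrite /tens3 /tens2 !tensmxE.
Qed.

(** The isometry into each enlarged space and the unitary that splits this space are merged into one
    isometry into a product of finite types. In the way back the unitaries are identities. *)
Definition triangle (A B D : finType) (psi : A -> B -> D -> C) : Prop :=
  exists (AL AR BL BR CL CR : finType)
    (VA : AL * AR -> A -> C) (VB : BL * BR -> B -> C) (VC : CL * CR -> D -> C)
    (f : AR -> BL -> C) (g : BR -> CL -> C) (h : CR -> AL -> C),
  [/\ adj VA ** VA = @fid R A, adj VB ** VB = @fid R B & adj VC ** VC = @fid R D] /\
  [/\ fnsq f = 1, fnsq g = 1 & fnsq h = 1] /\
  forall xl xr yl yr zl zr,
    \sum_a \sum_b \sum_c VA (xl, xr) a * VB (yl, yr) b * VC (zl, zr) c * psi a b c =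
    f xr yl * g yr zl * h zr xl.

Lemma isometry_tens2 m n p (V : 'M[C]_(m * n, p)) :
  Defs.isometry V -> adj (fun x : 'I_m * 'I_n => V (tens2 x.1 x.2)) **
    (fun x : 'I_m * 'I_n => V (tens2 x.1 x.2)) = @fid R 'I_p.
Proof.
move=> /isometryP <-; apply: (fmul_reindexr (adj (fun i j => V i j)) (fun i j => V i j) (tens2_bij m n)).
Qed.

Lemma fnsq_enum (T U : finType) (f : T -> U -> C) :
  fnsq (fun (i : 'I_#|T|) (j : 'I_#|U|) => f (enum_val i) (enum_val j)) = fnsq f.
Proof.
rewrite /fnsq [RHS](reindex (enum_val : 'I_#|T| -> T)) /=; last exact/onW_bij/enum_val_bij.
apply: eq_bigr => i _; rewrite [RHS](reindex (enum_val : 'I_#|U| -> U)) //=.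
exact/onW_bij/enum_val_bij.
Qed.

Definition cvec (T U : finType) (f : T -> U -> C) : 'cV[C]_(#|T| * #|U|) :=
  \col_s f (enum_val (mxtens_unindex s).1) (enum_val (mxtens_unindex s).2).

Lemma cvec_pure (T U : finType) (f : T -> U -> C) : fnsq f = 1 -> pure_state (cvec f).
Proof.
move=> f1; apply/fnsq_tens2; rewrite -f1 -(fnsq_enum f); congr fnsq; apply: fext => i j.
by rewrite mxE unindex_tens2.
Qed.

Definition mxiso (S T : finType) n (V : S * T -> 'I_n -> C) : 'M[C]_(#|S| * #|T|, n) :=
  \matrix_(s, i) V (enum_val (mxtens_unindex s).1, enum_val (mxtens_unindex s).2) i.

Lemma mxiso_isometry (S T : finType) n (V : S * T -> 'I_n -> C) :
  adj V ** V = @fid R 'I_n -> Defs.isometry (mxiso V).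
Proof.
move=> VV; apply/isometryP; rewrite -VV.
pose h (s : 'I_(#|S| * #|T|)) := (enum_val (mxtens_unindex s).1, enum_val (mxtens_unindex s).2).
have bh : bijective h.
  exists (fun x : S * T => tens2 (enum_rank x.1) (enum_rank x.2)) => [s|[x y]].
    by rewrite /h /tens2 !enum_valK -surjective_pairing mxtens_unindexK.
  by rewrite /h unindex_tens2 !enum_rankK.
rewrite -(fmul_reindexr (adj V) V bh); congr (_ ** _); apply: fext => i j; last by rewrite mxE.
by rewrite /adj mxE.
Qed.

Lemma triangleP (a b c : nat) (psi : 'cV[C]_(a * b * c)) :
  triangle_up_to_isometries psi <-> triangle (fun i j k => psi (tens3 i j k) 0).
Proof.
split.
  case=> a' [b' [c' [VA [VB [VC [[iA iB iC]]]]]]].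
  case=> aL [aR [bL [bR [cL [cR [UA [UB [UC [vAB [vBC [vCA]]]]]]]]]]].
  case=> -[[uA _] [uB _] [uC _]] [[nAB nBC nCA] e].
  have iso m n p (U : 'M[C]_(m, n)) (V : 'M[C]_(n, p)) :
      Defs.isometry U -> Defs.isometry V -> Defs.isometry (U *m V).
    rewrite /Defs.isometry => UU VV; rewrite trmx_mul map_mxM.
    by rewrite mulmxA -[_ *m U^t* *m U]mulmxA UU mulmx1.
  exists 'I_aL, 'I_aR, 'I_bL, 'I_bR, 'I_cL, 'I_cR.
  exists (fun x => (UA *m VA) (tens2 x.1 x.2)), (fun x => (UB *m VB) (tens2 x.1 x.2)),
    (fun x => (UC *m VC) (tens2 x.1 x.2)).
  exists (fun i j => vAB (tens2 i j) 0), (fun i j => vBC (tens2 i j) 0),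
    (fun i j => vCA (tens2 i j) 0).
  split; first by split; apply: isometry_tens2; exact: iso.
  split; first by split; exact/fnsq_tens2.
  move=> xl xr yl yr zl zr /=; rewrite -e mulmxA !tensmx_mul tens3_apply.
  by [].
case=> AL [AR [BL [BR [CL [CR [VA [VB [VC [f [g [h [[iA iB iC]]]]]]]]]]]]].
case=> -[nf ng nh] e.
exists (#|AL| * #|AR|)%N, (#|BL| * #|BR|)%N, (#|CL| * #|CR|)%N.
exists (mxiso VA), (mxiso VB), (mxiso VC); split; first by split; exact: mxiso_isometry.
exists #|AL|, #|AR|, #|BL|, #|BR|, #|CL|, #|CR|, 1%:M, 1%:M, 1%:M, (cvec f), (cvec g), (cvec h).
have u1 n : unitary (1%:M : 'M[C]_n).
  by rewrite /unitary trmx1 map_mx1 mulmx1.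
split; first by split; exact: u1.
split; first by split; exact: cvec_pure.
move=> xl xr yl yr zl zr; rewrite mulmxA !tensmx_mul !mul1mx tens3_apply.
rewrite !mxE !unindex_tens2 -e; apply: eq_bigr => i _; apply: eq_bigr => j _.
by apply: eq_bigr => k _; rewrite !mxE !unindex_tens2.
Qed.

Section Entropies.
Variables (a b c : nat) (psi : 'cV[C]_(a * b * c)).
Let f i j k : C := psi (tens3 i j k) 0.

Lemma densityE n (v : 'cV[C]_n) s t : density v s t = v s 0 * (v t 0)^*.
Proof. by rewrite mxE big_ord1 !mxE. Qed.

Lemma mutual_informationE : mutual_information (ptrace_r (density psi)) =
  vN (fun i (w : 'I_b * 'I_c) => f i w.1 w.2) + vN (fun j (w : 'I_a * 'I_c) => f w.1 j w.2) -
  vN (fun (w : 'I_a * 'I_b) k => f w.1 w.2 k).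
Proof.
rewrite /mutual_information; congr (_ + _ - _).
- apply: (entropy_gram (h := id)); first by exists id.
  move=> i j; rewrite mxE [RHS]sum_pair; apply: eq_bigr => k _; rewrite mxE.
  by apply: eq_bigr => z _; rewrite densityE.
- apply: (entropy_gram (h := id)); first by exists id.
  move=> i j; rewrite mxE [RHS]sum_pair; apply: eq_bigr => k _; rewrite mxE.
  by apply: eq_bigr => z _; rewrite densityE.
apply: (entropy_gram (h := @mxtens_unindex a b)); first exact: unindex_bij.
move=> s t; rewrite mxE; apply: eq_bigr => k _; rewrite densityE.
by rewrite /adj /f /tens3 !tens2K.
Qed.

(** The Gram matrix of [cutAL phi] is rho_AL and that of [cutAB phi] is rho_AB. *)
Definition cutAL (A B L Q D : Type) (phi : A -> B -> L -> Q -> D) : A * L -> B * Q -> D :=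
  fun w w' => phi w.1 w'.1 w.2 w'.2.

Definition cutAB (A B L Q D : Type) (phi : A -> B -> L -> Q -> D) : A * B -> L * Q -> D :=
  fun w w' => phi w.1 w.2 w'.1 w'.2.

Lemma marginal13E l r (phi : 'cV[C]_(a * b * l * r)) :
  entropy (marginal13 (density phi)) = vN (cutAL (fun i j k z => phi (tens4 i j k z) 0)).
Proof.
apply: (entropy_gram (h := @mxtens_unindex a l)); first exact: unindex_bij.
move=> s t; rewrite mxE; case: (mxtens_unindex s) => i k; case: (mxtens_unindex t) => i' k'.
rewrite [RHS]sum_pair; apply: eq_bigr => j _; apply: eq_bigr => z _.
by rewrite densityE.
Qed.

Lemma purifiesP l r (phi : 'cV[C]_(a * b * l * r)) : pure_state psi ->
  purifies phi (ptrace_r (density psi)) <->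
  gram (cutAB (fun i j k z => phi (tens4 i j k z) 0)) = gram (fun w k => f w.1 w.2 k).
Proof.
move=> psi1.
have psiE i j i' j' : ptrace_r (density psi) (tens2 i j) (tens2 i' j') =
    gram (fun w k => f w.1 w.2 k) (i, j) (i', j').
  by rewrite mxE; apply: eq_bigr => k _; rewrite densityE.
have phiE i j i' j' : ptrace_r (ptrace_r (density phi)) (tens2 i j) (tens2 i' j') =
    gram (cutAB (fun i j k z => phi (tens4 i j k z) 0)) (i, j) (i', j').
  rewrite mxE [RHS]sum_pair; apply: eq_bigr => k _; rewrite mxE.
  by apply: eq_bigr => z _; rewrite densityE.
split=> [[_ e]|e].
  by apply: fext => -[i j] [i' j']; rewrite -phiE -psiE e.
split; last first.
  apply/matrixP => s t; rewrite -(mxtens_unindexK s) -(mxtens_unindexK t).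
  case: (mxtens_unindex s) => i j; case: (mxtens_unindex t) => i' j'.
  by rewrite -/(tens2 i j) -/(tens2 i' j') phiE e psiE.
(* The squared norm of [phi] is the trace of its Gram matrix, which is that of [psi]. *)
apply/pure_stateP; move/pure_stateP : psi1 => <-; apply: complexI.
transitivity (ftr (gram (cutAB (fun i j k z => phi (tens4 i j k z) 0)))).
  rewrite ftr_gram; congr (_%:C%C); rewrite sum_tens2 sum_tens2 sum_tens2 /fnsq sum_pair.
  by apply: eq_bigr => i _; apply: eq_bigr => j _; rewrite sum_pair.
rewrite e ftr_gram; congr (_%:C%C); rewrite sum_tens2 sum_tens2 /fnsq sum_pair.
by [].
Qed.

Lemma cvec4_exists l r (phi : 'I_a -> 'I_b -> 'I_l -> 'I_r -> C) :
  exists v : 'cV[C]_(a * b * l * r), (fun i j k z => v (tens4 i j k z) 0) = phi.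
Proof.
pose F (s : 'I_(a * b * l * r)) := let u := mxtens_unindex s in let v := mxtens_unindex u.1 in
  let w := mxtens_unindex v.1 in phi w.1 w.2 v.2 u.2.
exists (\col_s F s).
do 4!(apply/funext => ?).
by rewrite mxE /F /tens4 /tens3 !unindex_tens2.
Qed.

End Entropies.

End Translation.

(** * The gap between 2 S(AL) and the mutual information *)

Section Gap.
Variable R : realType.
Local Notation C := R[i].

Definition mutinf (A B D : finType) (psi : A -> B -> D -> C) : R :=
  vN (fun i (w : B * D) => psi i w.1 w.2) + vN (fun j (w : A * D) => psi w.1 j w.2) -
  vN (fun (w : A * B) k => psi w.1 w.2 k).

Lemma mutinf_gram (A B D D' : finType) (psi : A -> B -> D -> C) (psi' : A -> B -> D' -> C) :
  gram (fun (w : A * B) k => psi w.1 w.2 k) = gram (fun (w : A * B) k => psi' w.1 w.2 k) ->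
  mutinf psi = mutinf psi'.
Proof.
move=> e.
have e1 : gram (fun i (w : B * D) => psi i w.1 w.2) = gram (fun i (w : B * D') => psi' i w.1 w.2).
  rewrite [LHS]gram_ptrace [RHS]gram_ptrace; apply: fext => i i'; apply: eq_bigr => j _.
  exact: (congr1 (fun f => f (i, j) (i', j)) e).
have e2 : gram (fun j (w : A * D) => psi w.1 j w.2) = gram (fun j (w : A * D') => psi' w.1 j w.2).
  rewrite [LHS]gram_ptrace [RHS]gram_ptrace; apply: fext => j j'; apply: eq_bigr => i _.
  exact: (congr1 (fun f => f (i, j) (i, j')) e).
by rewrite /mutinf (vN_gram e1) (vN_gram e2) (vN_gram e).
Qed.

Section FourParties.
Variables (A B L Q : finType) (phi : A -> B -> L -> Q -> C).
Hypothesis phi1 : fnsq (cutAB phi) = 1.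

Let psi i j (w : L * Q) := phi i j w.1 w.2.
Let M (w : L * (B * Q)) i := phi i w.2.1 w.1 w.2.2.

Let M1 : fnsq M = 1.
Proof.
rewrite -phi1 /fnsq !sum_pair; under eq_bigr do rewrite sum_pair.
under [RHS]eq_bigr do under eq_bigr do rewrite sum_pair.
under eq_bigr do under eq_bigr do rewrite exchange_big.
under eq_bigr do rewrite exchange_big.
rewrite exchange_big; apply: eq_bigr => i _; rewrite exchange_big.
by [].
Qed.

(** Strong subadditivity for A, B, Q gives S(B) + S(ABQ) <= S(AB) + S(BQ), where purity turns S(ABQ)
    into S(L) and S(BQ) into S(AL). The bracket is I(L:BQ), with S(LBQ) = S(A). *)
Lemma mutinf_gap :
  mutinf psi + (vN (partl M) + vN (partr M) - vN M) <= 2 * vN (cutAL phi).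
Proof.
have := strong_subadditivity (fun i j z l => phi i j l z).
set tY := vN _; set tXYZ := vN _; set tXY := vN _; set tYZ := vN _ => H.
have eY : tY = vN (fun j (w : A * (L * Q)) => psi w.1 j w.2).
  apply: (@vN_bij _ B B (A * (L * Q))%type _ id (fun w => (w.1, (w.2.2, w.2.1)))
    (fun j w => psi w.1 j w.2)); first by exists id.
  by exists (fun w => (w.1, (w.2.2, w.2.1))) => -[? []].
have eXYZ : tXYZ = vN (partl M).
  rewrite -[RHS]vN_trp.
  apply: (@vN_bij _ ((B * Q) * A)%type _ L L (fun w => (w.2, w.1)) id (trp (partl M))).
    by exists (fun w => (w.2, w.1)) => -[].
  by exists id.
have eXY : tXY = vN (fun (w : A * B) k => psi w.1 w.2 k).
  apply: (@vN_bij _ (A * B)%type _ (L * Q)%type _ id (fun w => (w.2, w.1))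
    (fun w k => psi w.1 w.2 k)); first by exists id.
  by exists (fun w => (w.2, w.1)) => -[].
have eYZ : tYZ = vN (cutAL phi) by exact: vN_trp (cutAL phi).
have ePart : vN (partr M) = vN (cutAL phi).
  rewrite -[RHS]vN_trp.
  apply: (@vN_bij _ (B * Q)%type _ (A * L)%type _ id (fun w => (w.2, w.1)) (trp (cutAL phi))).
    by exists id.
  by exists (fun w => (w.2, w.1)) => -[].
have eM : vN M = vN (fun i (w : B * (L * Q)) => psi i w.1 w.2).
  rewrite -[LHS]vN_trp.
  apply: (@vN_bij _ A A (B * (L * Q))%type _ id (fun w => (w.2.1, (w.1, w.2.2)))
    (fun i w => psi i w.1 w.2)); first by exists id.
  by exists (fun w => (w.2.1, (w.1, w.2.2))) => -[? []].
rewrite /mutinf -eY -eXY -eM ePart -eXYZ -eYZ.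
move: H; clear; move: (vN M) => ?; move: tY tXYZ tXY tYZ => *; lra.
Qed.

Lemma mutinf_le : mutinf psi <= 2 * vN (cutAL phi).
Proof. by have := mutinf_gap; have := subadditivity M1; lra. Qed.

Lemma mutinf_eq : 2 * vN (cutAL phi) <= mutinf psi ->
  gram M = kron (gram (partl M)) (gram (partr M)).
Proof. by move=> H; apply: subadditivity_eq M1 _; have := mutinf_gap; lra. Qed.

End FourParties.

Lemma mutinf_swap (A B D D' : finType) (h : D' -> D) (psi : A -> B -> D -> C) : bijective h ->
  mutinf (fun j i w => psi i j (h w)) = mutinf psi.
Proof.
move=> bh; have bij2 (T : finType) : bijective (fun w : T * D' => (w.1, h w.2)).
  case: bh => k hk kh; exists (fun w => (w.1, k w.2)) => -[x y] /=; by rewrite ?hk ?kh.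
have id_bij (T : Type) : bijective (@id T) by exists id.
have e1 := vN_bij (fun i (w : B * D) => psi i w.1 w.2) (id_bij A) (bij2 B).
have e2 := vN_bij (fun j (w : A * D) => psi w.1 j w.2) (id_bij B) (bij2 A).
have flip_bij : bijective (fun w : B * A => (w.2, w.1)).
  by exists (fun w => (w.2, w.1)) => -[].
have e3 := vN_bij (fun (w : A * B) k => psi w.1 w.2 k) flip_bij bh.
rewrite /mutinf -e1 -e2 -e3; congr (_ - _); exact: addrC.
Qed.

End Gap.

(** * Entropies of triangle states *)

Section TriangleEntropies.
Variable R : realType.
Local Notation C := R[i].

Lemma vN_isometry2 (T T' U U' : finType) (W : T' -> T -> C) (W' : U' -> U -> C)
    (M : T -> U -> C) :
  adj W ** W = @fid R T -> adj W' ** W' = @fid R U -> vN (W ** M ** trp W') = vN M.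
Proof.
move=> WW WW'; rewrite -vN_trp trpM; have -> : trp (trp W') = W' by [].
by rewrite vN_isometry // vN_trp vN_isometry.
Qed.

Lemma kron_isometry (S T S' T' : finType) (V : S' -> S -> C) (W : T' -> T -> C) :
  adj V ** V = @fid R S -> adj W ** W = @fid R T ->
  adj (kron V W) ** kron V W = @fid R (S * T)%type.
Proof. by move=> VV WW; rewrite adj_kron kron_mul VV WW kron_fid. Qed.

Lemma fnsq_kron (S T S' T' : finType) (f : S -> T -> C) (g : S' -> T' -> C) :
  fnsq (kron f g) = fnsq f * fnsq g.
Proof.
apply: complexI; rewrite rmorphM /= -!ftr_gram gram_kron /ftr sum_pair big_distrlr.
by [].
Qed.

(** Meant for the three pairs of a triangle: a pair lying wholly on one side of the cut enters with
    [unit] as its other side and contributes zero. *)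
Lemma vN_prod3 (T U T1 U1 T2 U2 T3 U3 : finType) (u : T -> T1 * T2 * T3)
    (v : U -> U1 * U2 * U3) (f1 : T1 -> U1 -> C) (f2 : T2 -> U2 -> C) (f3 : T3 -> U3 -> C)
    (N : T -> U -> C) :
  bijective u -> bijective v -> fnsq f1 = 1 -> fnsq f2 = 1 -> fnsq f3 = 1 ->
  (forall t w, N t w = f1 (u t).1.1 (v w).1.1 * f2 (u t).1.2 (v w).1.2 * f3 (u t).2 (v w).2) ->
  vN N = vN f1 + vN f2 + vN f3.
Proof.
move=> bu bv n1 n2 n3 NE.
have -> : N = fun t w => kron (kron f1 f2) f3 (u t) (v w) by apply: fext => t w; rewrite NE.
by rewrite (vN_bij _ bu bv) !vN_kron // fnsq_kron n1 n2 mulr1.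
Qed.

Section Triangle.
Variables AL AR BL BR CL CR : finType.
Variables (f : AR -> BL -> C) (g : BR -> CL -> C) (h : CR -> AL -> C).
Hypotheses (f1 : fnsq f = 1) (g1 : fnsq g = 1) (h1 : fnsq h = 1).

Definition triangle_amp (x : AL * AR) (y : BL * BR) (z : CL * CR) : C :=
  f x.2 y.1 * g y.2 z.1 * h z.2 x.1.

Lemma fnsq_trp (T U : finType) (M : T -> U -> C) : fnsq (trp M) = fnsq M.
Proof. by rewrite /fnsq exchange_big. Qed.

Definition colv (T U : Type) (M : T -> U -> C) : T * U -> unit -> C := fun w _ => M w.1 w.2.

Lemma fnsq_colv (T U : finType) (M : T -> U -> C) : fnsq (colv M) = fnsq M.
Proof.
by rewrite /fnsq sum_pair; apply: eq_bigr => t _; apply: eq_bigr => u _; rewrite sum_unit.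
Qed.

Lemma vN_colv (T U : finType) (M : T -> U -> C) : fnsq M = 1 -> vN (colv M) = 0.
Proof. by move=> M1; apply: vN_pure; rewrite fnsq_colv. Qed.

Lemma vN_trp_colv (T U : finType) (M : T -> U -> C) : fnsq M = 1 -> vN (trp (colv M)) = 0.
Proof. by move=> M1; rewrite vN_trp vN_colv. Qed.

Lemma triangle_vNA : vN (fun x (w : (BL * BR) * (CL * CR)) => triangle_amp x w.1 w.2) = vN f + vN h.
Proof.
rewrite (@vN_prod3 _ _ AR BL unit (BR * CL)%type AL CR (fun x => (x.2, tt, x.1))
   (fun w => (w.1.1, (w.1.2, w.2.1), w.2.2)) f (trp (colv g)) (trp h)).
- by rewrite vN_trp_colv // addr0 vN_trp.
- by exists (fun w => (w.2, w.1.1)) => [[? ?]|[[? []] ?]].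
- by exists (fun w => ((w.1.1, w.1.2.1), (w.1.2.2, w.2))) => [[[? ?] [? ?]]|[[? [? ?]] ?]].
- exact: f1.
- by rewrite fnsq_trp fnsq_colv.
- by rewrite fnsq_trp.
by [].
Qed.

Lemma triangle_vNB : vN (fun y (w : (AL * AR) * (CL * CR)) => triangle_amp w.1 y w.2) = vN f + vN g.
Proof.
rewrite (@vN_prod3 _ _ BL AR BR CL unit (CR * AL)%type (fun y => (y.1, y.2, tt))
   (fun w => (w.1.2, w.2.1, (w.2.2, w.1.1))) (trp f) g (trp (colv h))).
- by rewrite vN_trp_colv // addr0 vN_trp.
- by exists (fun w => w.1) => [[? ?]|[[? ?] []]].
- by exists (fun w => ((w.2.2, w.1.1), (w.1.2, w.2.1))) => [[[? ?] [? ?]]|[[? ?] [? ?]]].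
- by rewrite fnsq_trp.
- exact: g1.
- by rewrite fnsq_trp fnsq_colv.
by [].
Qed.

Lemma triangle_vNC : vN (fun (w : (AL * AR) * (BL * BR)) z => triangle_amp w.1 w.2 z) = vN g + vN h.
Proof.
rewrite (@vN_prod3 _ _ (AR * BL)%type unit BR CL AL CR (fun w => ((w.1.2, w.2.1), w.2.2, w.1.1))
   (fun z => (tt, z.1, z.2)) (colv f) g (trp h)).
- by rewrite vN_colv // add0r vN_trp.
- by exists (fun w => ((w.2, w.1.1.1), (w.1.1.2, w.1.2))) => [[[? ?] [? ?]]|[[[? ?] ?] ?]].
- by exists (fun w => (w.1.2, w.2)) => [[? ?]|[[[] ?] ?]].
- by rewrite fnsq_colv.
- exact: g1.
- by rewrite fnsq_trp.
by [].
Qed.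

Lemma triangle_vNAL : vN (fun (w : (AL * AR) * CR) (w' : (BL * BR) * CL) =>
  triangle_amp w.1 w'.1 (w'.2, w.2)) = vN f.
Proof.
rewrite (@vN_prod3 _ _ AR BL unit (BR * CL)%type (CR * AL)%type unit
   (fun w => (w.1.2, tt, (w.2, w.1.1)))
   (fun w => (w.1.1, (w.1.2, w.2), tt)) f (trp (colv g)) (colv h)).
- by rewrite vN_trp_colv // vN_colv // !addr0.
- by exists (fun w => ((w.2.2, w.1.1), w.2.1)) => [[[? ?] ?]|[[? []] [? ?]]].
- by exists (fun w => ((w.1.1, w.1.2.1), w.1.2.2)) => [[[? ?] ?]|[[? [? ?]] []]].
- exact: f1.
- by rewrite fnsq_trp fnsq_colv.
- by rewrite fnsq_colv.
by [].
Qed.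

End Triangle.

Lemma sum3_perm (A B D : finType) (V : nmodType) (F : A -> B -> D -> V) :
  \sum_i \sum_j \sum_k F i j k = \sum_k \sum_i \sum_j F i j k.
Proof. by under eq_bigr do rewrite exchange_big; rewrite exchange_big. Qed.

Lemma sum_kron_fid (S T T' : finType) (V : S -> T -> C) (F : T * T' -> C) x :
  \sum_w kron V (@fid R T') x w * F w = \sum_t V x.1 t * F (t, x.2).
Proof.
rewrite sum_pair; apply: eq_bigr => t _; rewrite (bigD1 x.2) //= big1 ?addr0 => [|t' /negPf ne].
  by rewrite /kron /fid /= eqxx mulr1.
by rewrite /kron /fid /= eq_sym ne mulr0 mul0r.
Qed.

(** Each party's entropy is the sum over its two edges, so the mutual information is (f + h) + (f +
    g) - (g + h) = 2 f in terms of the edge entropies, and [f] is the only edge that crosses the cut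
    between A C_R and B C_L. *)
Theorem triangle_optimal (A B D : finType) (psi : A -> B -> D -> C) : triangle psi ->
  exists (L Q : finType) (phi : A -> B -> L -> Q -> C),
    gram (cutAB phi) = gram (fun (w : A * B) k => psi w.1 w.2 k) /\
    2 * vN (cutAL phi) = mutinf psi.
Proof.
case=> AL [AR [BL [BR [CL [CR [VA [VB [VC [f [g [h [[iA iB iC]]]]]]]]]]]]].
case=> -[f1 g1 h1] e.
have eamp x y z : \sum_a \sum_b \sum_c VA x a * VB y b * VC z c * psi a b c = triangle_amp f g h x y z.
  by case: x y z => [xl xr] [yl yr] [zl zr]; rewrite e.
pose phi a b zr zl := \sum_c VC (zl, zr) c * psi a b c.
exists CR, CL, phi; split.
  pose P c (w : CR * CL) := VC (w.2, w.1) c.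
  have -> : cutAB phi = (fun (w : A * B) k => psi w.1 w.2 k) ** P.
    by apply: fext => w w'; apply: eq_bigr => c _; rewrite mulrC.
  have PP : P ** adj P = @fid R D.
    rewrite -trp_fid -iC; apply: fext => c c'; rewrite /fmul /trp sum_pair [RHS]sum_pair exchange_big.
    by apply: eq_bigr => x _; apply: eq_bigr => y _; rewrite mulrC.
  by rewrite /gram adjM -fmulA (fmulA P) PP fmul1l.
have eA : vN (fun i (w : B * D) => psi i w.1 w.2) = vN f + vN h.
  rewrite -(triangle_vNA f1 g1 h1) -(vN_isometry2 _ iA (kron_isometry iB iC)); congr vN.
  apply: fext => x [y z]; rewrite -eamp /fmul; under eq_bigr do rewrite big_distrl.
  rewrite exchange_big; apply: eq_bigr => a _; rewrite sum_pair.
  by apply: eq_bigr => b _; apply: eq_bigr => c _; rewrite /trp /kron /=; ring.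
have eB : vN (fun j (w : A * D) => psi w.1 j w.2) = vN f + vN g.
  rewrite -(triangle_vNB f1 g1 h1) -(vN_isometry2 _ iB (kron_isometry iA iC)); congr vN.
  apply: fext => y [x z]; rewrite -eamp /fmul; under eq_bigr do rewrite big_distrl.
  rewrite exchange_big [RHS]exchange_big; apply: eq_bigr => b _; rewrite sum_pair.
  by apply: eq_bigr => a _; apply: eq_bigr => c _; rewrite /trp /kron /=; ring.
have eC : vN (fun (w : A * B) k => psi w.1 w.2 k) = vN g + vN h.
  rewrite -(triangle_vNC f1 g1 h1) -vN_trp -[RHS]vN_trp.
  rewrite -(vN_isometry2 _ iC (kron_isometry iA iB)); congr vN.
  apply: fext => z [x y]; rewrite /trp -eamp /fmul; under eq_bigr do rewrite big_distrl.
  rewrite exchange_big [RHS]sum3_perm; apply: eq_bigr => c _; rewrite sum_pair.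
  by apply: eq_bigr => a _; apply: eq_bigr => b _; rewrite /kron /=; ring.
have eAL : vN (cutAL phi) = vN f.
  have fid_iso (T : finType) : adj (@fid R T) ** @fid R T = @fid R T by rewrite adj_fid fmul1l.
  rewrite -(triangle_vNAL f1 g1 h1).
  rewrite -(vN_isometry2 _ (kron_isometry iA (fid_iso CR)) (kron_isometry iB (fid_iso CL))).
  congr vN; apply: fext => -[x zr] [y zl]; rewrite -eamp /fmul.
  under eq_bigr do rewrite mulrC.
  rewrite /trp sum_kron_fid exchange_big; apply: eq_bigr => b _ /=.
  rewrite sum_kron_fid big_distrr; apply: eq_bigr => a _ /=.
  rewrite /cutAL /phi /= !big_distrr; apply: eq_bigr => c _ /=; ring.
rewrite /mutinf eA eB eC eAL; move: (vN f) (vN g) (vN h) => *; ring.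
Qed.

End TriangleEntropies.

(** * Optimal purifications come from triangle states *)

Section OptimalIsTriangle.
Variable R : realType.
Local Notation C := R[i].

Lemma fnsq_reindex (T U T' U' : finType) (F : T -> U -> C) (F' : T' -> U' -> C)
    (u : T * U -> T' * U') : bijective u ->
  (forall t w, F t w = F' (u (t, w)).1 (u (t, w)).2) -> fnsq F = fnsq F'.
Proof.
move=> bu FE; rewrite /fnsq.
transitivity (\sum_w nsq (F' (u w).1 (u w).2)).
  by rewrite sum_pair; apply: eq_bigr => t _; apply: eq_bigr => w _; rewrite FE.
transitivity (\sum_w nsq (F' w.1 w.2)); last by rewrite sum_pair.
rewrite [RHS](reindex u) //; exact: onW_bij.
Qed.

Lemma fnsq_inhabited (T U : finType) (M : T -> U -> C) : fnsq M = 1 -> exists t u, M t u != 0.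
Proof.
move=> M1; apply: contrapT => H; have : fnsq M = 0.
  apply: big1 => t _; apply: big1 => u _; have [->|/eqP n0] := eqVneq (M t u) 0.
    by rewrite /nsq /= expr0n /= addr0.
  by case: H; exists t, u; apply/eqP.
by rewrite M1 => /eqP; rewrite oner_eq0.
Qed.

Lemma fnsq_pad (T P U : finType) (F : T + P -> U -> C) :
  (forall p u, F (inr p) u = 0) -> fnsq F = fnsq (fun t => F (inl t)).
Proof.
move=> F0; rewrite /fnsq big_sumType /= [X in _ + X]big1 ?addr0 // => p _.
by apply: big1 => u _; rewrite F0 /nsq /= expr0n /= addr0.
Qed.

Theorem optimal_triangle (A B D L Q : finType) (psi : A -> B -> D -> C)
    (phi : A -> B -> L -> Q -> C) :
  fnsq (fun (w : A * B) k => psi w.1 w.2 k) = 1 ->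
  gram (cutAB phi) = gram (fun (w : A * B) k => psi w.1 w.2 k) ->
  2 * vN (cutAL phi) <= mutinf psi -> triangle psi.
Proof.
move=> psi1 ephi opt.
have phi1 : fnsq (cutAB phi) = 1 by apply: complexI; rewrite -ftr_gram ephi ftr_gram psi1.
(* Exchanging A with B and L with Q makes the same gap estimate decouple Q from AL. *)
pose phi' j i z k := phi i j k z.
have phi1' : fnsq (cutAB phi') = 1.
  rewrite -phi1; apply: (@fnsq_reindex _ _ _ _ _ _ (fun w => ((w.1.2, w.1.1), (w.2.2, w.2.1)))) => //.
  by exists (fun w => ((w.1.2, w.1.1), (w.2.2, w.2.1))) => -[[? ?] [? ?]].
have emi : mutinf psi = mutinf (fun i j (w : L * Q) => phi i j w.1 w.2) by apply: mutinf_gram; rewrite -ephi.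
have flip_bij : bijective (fun w : Q * L => (w.2, w.1)) by exists (fun w => (w.2, w.1)) => -[].
have emi' : mutinf psi = mutinf (fun i j (w : Q * L) => phi' i j w.1 w.2).
  exact: etrans emi (esym (mutinf_swap (fun i j (w : L * Q) => phi i j w.1 w.2) flip_bij)).
have opt1 := opt; rewrite emi in opt1; have H1 := mutinf_eq phi1 opt1.
have opt2 : 2 * vN (cutAL phi') <= mutinf (fun i j (w : Q * L) => phi' i j w.1 w.2).
  by rewrite -emi' -[cutAL phi']/(trp (cutAL phi)) vN_trp.
have H2 := mutinf_eq phi1' opt2.
have [WA [iA eA]] := decouple H1.
have [WB [iB eB]] := decouple H2.
pose X := trp (fun (w : A * B) k => psi w.1 w.2 k).
have [WC [iC eC]] : exists W : (L * Q) + D -> D -> C, adj W ** W = @fid R D /\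
    forall s u, (W ** X) s u = if s is inl s then trp (cutAB phi) s u else 0.
  apply: gram_isometry; have := congr1 (@trp R _ _) ephi.
  by rewrite /gram !trpM => ->.
have [[a0 b0] [[l0 q0] _]] := fnsq_inhabited phi1.
have [VA [jA dA]] := pad_isometry ((b0, q0), a0) iA.
(* The two outputs are swapped so that the factor facing [A] is the left one. *)
pose WB' (s : ((Q * B) * ((A * L) * B)) + B) :=
  WB (match s with inl (x, y) => inl (y, x) | inr p => inr p end).
have iB' : adj WB' ** WB' = @fid R B.
  rewrite -iB; apply: (fmul_reindexr (adj WB) WB).
  by exists (fun s => match s with inl (x, y) => inl (y, x) | inr p => inr p end) => [[[]|]|[[]|]].
have [VB [jB dB]] := pad_isometry (q0, b0) iB'.
have [VC' [jC dC]] := pad_isometry l0 iC.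
pose VC (z : (Q + D) * L) := VC' (z.2, z.1).
have jC' : adj VC ** VC = @fid R D.
  rewrite -jC; apply: (fmul_reindexr (adj VC') VC').
  by exists (fun w => (w.2, w.1)) => -[].
pose f (x : (L * A) + A) (y : Q * B) : C := if x is inl s then phi s.2 y.2 s.1 y.1 else 0.
pose g (y : ((A * L) * B) + B) (z : Q + D) : C :=
  if y is inl t then if z is inl q then phi t.1.1 t.2 t.1.2 q else 0 else 0.
pose h (z : L) (x : (B * Q) * A) : C := phi x.2 x.1.1 z x.1.2.
exists ((B * Q) * A)%type, ((L * A) + A)%type, (Q * B)%type, (((A * L) * B) + B)%type, (Q + D)%type, L.
exists VA, VB, VC, f, g, h; split; first by split.
split.
  split.
  - have bu : bijective (fun w : (L * A) * (Q * B) => ((w.1.2, w.2.2), (w.1.1, w.2.1))).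
      by exists (fun w => ((w.2.1, w.1.1), (w.2.2, w.1.2))) => -[[? ?] [? ?]].
    apply: etrans (fnsq_pad (F := f) (fun _ _ => erefl)) _.
    by rewrite -phi1; exact: (fnsq_reindex bu (fun _ _ => erefl)).
  - have bu : bijective (fun w : ((A * L) * B) * Q => ((w.1.1.1, w.1.2), (w.1.1.2, w.2))).
      by exists (fun w => (((w.1.1, w.2.1), w.1.2), w.2.2)) => [[[[? ?] ?] ?]|[[? ?] [? ?]]].
    apply: etrans (fnsq_pad (F := g) (fun _ _ => erefl)) _.
    rewrite -fnsq_trp; apply: etrans (fnsq_pad _) _ => [//|].
    rewrite -fnsq_trp -phi1; exact: (fnsq_reindex bu (fun _ _ => erefl)).
  have bu : bijective (fun w : L * ((B * Q) * A) => ((w.2.2, w.2.1.1), (w.1, w.2.1.2))).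
    by exists (fun w => (w.2.1, ((w.1.2, w.2.2), w.1.1))) => [[? [[? ?] ?]]|[[? ?] [? ?]]].
  by rewrite -phi1; exact: (fnsq_reindex bu (fun _ _ => erefl)).
move=> xl xr yl yr zl zr.
(* The isometries act in the order C, B, A. [VC] turns [psi] into [phi]; [VB] splits off [g] and
   leaves a copy of [phi] whose B and Q indices are those of [yl]; [VA] splits this copy into [h]
   and [f]. On padded indices both sides vanish. *)
have sC a b : \sum_c VC (zl, zr) c * psi a b c = if zl is inl q then phi a b zr q else 0.
  under eq_bigr do rewrite /VC dC; case: zl => [q|p] /=.
    exact: (eC (inl (zr, q)) (a, b)).
  under eq_bigr do rewrite -mulrA.
  rewrite -big_distrr /=; apply: etrans (congr1 _ (eC (inr p) (a, b))) _; exact: mulr0.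
transitivity (\sum_a \sum_b VA (xl, xr) a * (VB (yl, yr) b * (if zl is inl q then phi a b zr q else 0))).
  apply: eq_bigr => a _; apply: eq_bigr => b _; rewrite -sC !big_distrr /=.
  by apply: eq_bigr => c _; rewrite !mulrA.
case: zl {sC} => [q|p]; last first.
  rewrite /g; case: yr => [?|?]; rewrite mulr0 mul0r.
    by apply: big1 => a _; apply: big1 => b _; rewrite !mulr0.
  by apply: big1 => a _; apply: big1 => b _; rewrite !mulr0.
have sB a : \sum_b VB (yl, yr) b * phi a b zr q =
    g yr (inl q) * phi a yl.2 zr yl.1.
  under eq_bigr do rewrite dB; case: yr => [t|p] /=.
    exact: (eB (inl (t, yl)) q (a, zr)).
  under eq_bigr do rewrite -mulrA.
  rewrite -big_distrr /= mul0r; apply: etrans (congr1 _ (eB (inr p) q (a, zr))) _; exact: mulr0.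
transitivity (\sum_a VA (xl, xr) a * (g yr (inl q) * phi a yl.2 zr yl.1)).
  by apply: eq_bigr => a _; rewrite -sB big_distrr.
have sA : \sum_a VA (xl, xr) a * phi a yl.2 zr yl.1 = h zr xl * f xr yl.
  under eq_bigr do rewrite dA; case: xr => [s|p] /=.
    exact: (eA (inl (xl, s)) zr (yl.2, yl.1)).
  under eq_bigr do rewrite -mulrA.
  rewrite -big_distrr /= mulr0; apply: etrans (congr1 _ (eA (inr p) zr (yl.2, yl.1))) _; exact: mulr0.
under eq_bigr do rewrite mulrCA.
by rewrite -big_distrr /= sA; ring.
Qed.

End OptimalIsTriangle.

(** * Sparse solutions of linear programs *)

Section SparseWeights.
Variable R : realType.

Lemma dependent_weights (K N : finType) (v : K -> N -> R) (S : {set K}) :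
  (#|N| < #|S|)%N ->
  exists lam : K -> R, [/\ forall n, \sum_k lam k * v k n = 0,
    forall k, k \notin S -> lam k = 0 & exists k, lam k != 0].
Proof.
move=> NS; pose A : 'M[R]_(#|S|, #|N|) := \matrix_(i, j) v (enum_val i) (enum_val j).
have : kermx A != 0.
  by rewrite -mxrank_eq0 mxrank_ker subn_eq0 -ltnNge (leq_ltn_trans (rank_leq_col A)).
move=> /rowV0Pn [u /sub_kermxP uA u0].
pose lam k := \sum_(i < #|S|) if enum_val i == k then u 0 i else 0.
have lamE (F : K -> R) : \sum_k lam k * F k = \sum_i u 0 i * F (enum_val i).
  transitivity (\sum_k \sum_(i < #|S|) (if enum_val i == k then u 0 i * F k else 0)).
    apply: eq_bigr => k _; rewrite big_distrl; apply: eq_bigr => i _ /=.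
    by case: ifP => _ //; rewrite mul0r.
  rewrite exchange_big; apply: eq_bigr => i _ /=; rewrite (bigD1 (enum_val i)) //= eqxx.
  by rewrite big1 ?addr0 // => k; rewrite eq_sym => /negPf ->.
have lam_val i : lam (enum_val i) = u 0 i.
  rewrite /lam (bigD1 i) //= eqxx big1 ?addr0 // => j ji.
  by case: eqP => // /enum_val_inj e; rewrite e eqxx in ji.
exists lam; split.
- move=> n; rewrite lamE; have := congr1 (fun M : 'rV[R]__ => M 0 (enum_rank n)) uA.
  by rewrite !mxE => e; rewrite -[RHS]e; apply: eq_bigr => i _; rewrite !mxE enum_rankK.
- move=> k kS; apply: big1 => i _; case: eqP => // e.
  by move: kS; rewrite -e enum_valP.
move/rV0Pn : u0 => [i ui]; exists (enum_val i); by rewrite lam_val.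
Qed.

(* The functional [tau], positive on the support, keeps the linear program bounded. *)
Lemma sparse_support (K N : finType) (v : K -> N -> R) (tau : N -> R) (c w : K -> R) :
  (forall k, 0 <= w k) -> (forall k, w k != 0 -> 0 < \sum_n tau n * v k n) ->
  exists w' : K -> R, [/\ forall k, 0 <= w' k,
    forall n, \sum_k w' k * v k n = \sum_k w k * v k n,
    \sum_k w' k * c k <= \sum_k w k * c k & (#|[set k | w' k != 0%R]| <= #|N|)%N].
Proof.
have [m] := ubnP #|[set k | w k != 0%R]|; elim: m w => // m IH w wm w0 wt.
have [wN|Nw] := leqP #|[set k | w k != 0%R]| #|N|; first by exists w.
suff [lam [lv lS [k0 lk0] lc]] : exists lam : K -> R, [/\ forall n, \sum_k lam k * v k n = 0,
    forall k, w k = 0 -> lam k = 0, exists k, lam k < 0 & \sum_k lam k * c k <= 0].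
  (* Ratio test: the largest step along [lam] that keeps all weights nonnegative annihilates the
     weight at [k1], so the support shrinks. *)
  pose k1 := [arg min_(k < k0 | lam k < 0) (w k / - lam k)]%O.
  have [l1 k1min] : lam k1 < 0 /\ forall k, lam k < 0 -> w k1 / - lam k1 <= w k / - lam k.
    by rewrite /k1; case: arg_minP.
  set s := w k1 / - lam k1 in k1min.
  have s0 : 0 <= s by rewrite divr_ge0 // oppr_ge0 ltW.
  pose w' k := w k + s * lam k.
  have w'0 k : 0 <= w' k.
    rewrite /w'; have [lk|lk] := ltP (lam k) 0; last by rewrite addr_ge0 // mulr_ge0.
    have := k1min k lk; rewrite ler_pdivlMr ?oppr_gt0 //; lra.
  have w'S k : w k = 0 -> w' k = 0 by move=> e; rewrite /w' e lS // mulr0 addr0.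
  have sumE (F : K -> R) : \sum_k w' k * F k = \sum_k w k * F k + s * \sum_k lam k * F k.
    rewrite big_distrr -big_split /=; apply: eq_bigr => k _; rewrite /w'; ring.
  have w'k1 : w' k1 = 0 by rewrite /w' /s; field; rewrite lt_eqF.
  have sub : [set k | w' k != 0] \proper [set k | w k != 0].
    apply/properP; split; first by apply/fintype.subsetP => k; rewrite !inE; apply: contra => /eqP /w'S ->.
    exists k1; rewrite !inE ?w'k1 ?eqxx //.
    by apply: contraTneq l1 => /lS ->; rewrite ltxx.
  have [||| w'' [h1 h2 h3 h4]] := IH w'.
  - exact: leq_trans (proper_card sub) wm.
  - exact: w'0.
  - by move=> k w'k; apply: wt; apply: contra w'k => /eqP /w'S ->.
  exists w''; split=> //.
    by move=> n; rewrite h2 sumE lv mulr0 addr0.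
  apply: le_trans h3 _; rewrite sumE gerDl; exact: mulr_ge0_le0.
have [lam [lv lS [k lk]]] := dependent_weights v Nw.
have lS' x : w x = 0 -> lam x = 0 by move=> e; apply: lS; rewrite inE e eqxx.
(* For [mu >= 0], pairing the relation with [tau] would give a vanishing sum of nonnegative terms,
   one of them positive. So a relation and its negative both have negative entries, and the sign can
   be chosen so that the cost does not rise. *)
have neg (mu : K -> R) : (forall n, \sum_k mu k * v k n = 0) ->
    (forall k, w k = 0 -> mu k = 0) -> mu k != 0 -> exists k, mu k < 0.
  move=> mv mS mk; apply: contrapT => H.
  have mu0 x : 0 <= mu x by rewrite leNgt; apply/negP => lx; apply: H; exists x.
  have : \sum_x mu x * (\sum_n tau n * v x n) = 0.
    transitivity (\sum_n tau n * \sum_x mu x * v x n).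
      under eq_bigr do rewrite big_distrr /=.
      under [RHS]eq_bigr do rewrite big_distrr /=.
      rewrite exchange_big; apply: eq_bigr => n _; apply: eq_bigr => x _; ring.
    by apply: big1 => n _; rewrite mv mulr0.
  have pos x : 0 <= mu x * (\sum_n tau n * v x n).
    have [e|/wt /ltW h] := eqVneq (w x) 0; first by rewrite mS // mul0r.
    exact: mulr_ge0.
  move=> /eqP; rewrite psumr_eq0 // => /allP /(_ k (mem_index_enum k)) /=.
  rewrite mulf_eq0 (negPf mk) /= gt_eqF //; apply: wt.
  by apply: contra mk => /eqP /mS ->.
have [lc|lc] := leP (\sum_k lam k * c k) 0.
  by exists lam; split=> //; exact: neg.
have sumN (F : K -> R) : \sum_k (- lam k) * F k = - \sum_k lam k * F k.
  by rewrite -sumrN; apply: eq_bigr => x _; rewrite mulNr.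
exists (fun x => - lam x); split.
- by move=> n; rewrite sumN lv oppr0.
- by move=> x /lS' ->; rewrite oppr0.
- apply: neg; last by rewrite oppr_eq0.
  + by move=> n; rewrite sumN lv oppr0.
  + by move=> x /lS' ->; rewrite oppr0.
by rewrite sumN oppr_le0 ltW.
Qed.

Lemma sparse_weights (K N : finType) (v : K -> N -> R) (tau : N -> R) (c w : K -> R) (k0 : K) :
  (forall k, 0 <= w k) -> (forall k, w k != 0 -> 0 < \sum_n tau n * v k n) ->
  exists (h : N -> K) (w' : N -> R), [/\ forall i, 0 <= w' i,
    forall n, \sum_i w' i * v (h i) n = \sum_k w k * v k n &
    \sum_i w' i * c (h i) <= \sum_k w k * c k].
Proof.
move=> w0 wt; have [u [u0 uv uc uN]] := sparse_support c w0 wt.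
set S := [set k | u k != 0] in uN.
pose f i := nth k0 (enum S) i.
pose h (n : N) := f (enum_rank n).
pose w' (n : N) := if (enum_rank n < #|S|)%N then u (h n) else 0.
have sumE (F : K -> R) : \sum_i w' i * F (h i) = \sum_k u k * F k.
  transitivity (\sum_(i < #|N| | (i < #|S|)%N) u (f i) * F (f i)).
    rewrite [RHS]big_mkcond [RHS](reindex (enum_rank : N -> 'I_#|N|)) /=; last first.
      exact/onW_bij/enum_rank_bij.
    by apply: eq_bigr => n _; rewrite /w'; case: ifP => _ //; rewrite mul0r.
  rewrite -(big_ord_widen _ (fun i => u (f i) * F (f i)) uN) cardE.
  rewrite -(big_mkord xpredT (fun i => u (f i) * F (f i))) -(big_nth k0 xpredT (fun k => u k * F k)).
  rewrite big_enum /=.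
  rewrite [RHS](bigID (mem S)) /= [X in _ + X]big1 ?addr0 // => k.
  by rewrite inE negbK => /eqP ->; rewrite mul0r.
exists h, w'; split.
- by move=> i; rewrite /w'; case: ifP.
- by move=> n; rewrite (sumE (fun k => v k n)) uv.
by rewrite sumE.
Qed.

End SparseWeights.

(** * Reduction of the ancilla dimensions *)

Section Reduction.
Variable R : realType.
Local Notation C := R[i].

Lemma ImZ (x : R) (z : C) : complex.Im (x%:C%C * z) = x * complex.Im z.
Proof. by case: z => a b /=; rewrite mul0r addr0. Qed.

Lemma Im_sum (I : Type) (r : seq I) (P : pred I) (F : I -> C) :
  complex.Im (\sum_(i <- r | P i) F i) = \sum_(i <- r | P i) complex.Im (F i).
Proof. exact: (big_morph _ (id1 := 0) (@raddfD _ _ (@complex.Im R : {additive _ -> _}))). Qed.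

Lemma nsqZ (x : R) (z : C) : nsq (x%:C%C * z) = x ^+ 2 * nsq z.
Proof. by rewrite /nsq ReZ ImZ; ring. Qed.

Lemma fnsq_cutAL (A B L Q : finType) (phi : A -> B -> L -> Q -> C) :
  fnsq (cutAL phi) = fnsq (cutAB phi).
Proof.
apply: (@fnsq_reindex _ _ _ _ _ _ _ (fun w => ((w.1.1, w.2.1), (w.1.2, w.2.2)))).
  by exists (fun w => ((w.1.1, w.2.1), (w.1.2, w.2.2))) => -[[? ?] [? ?]].
by [].
Qed.

(** There is one weight per basis vector of [Q] and one constraint per real or imaginary part of an
    entry of rho_AB, whence the new index type. The cost is - tr (rho' log rho_AL) with the original
    rho_AL in the logarithm: linear in the weights, equal to S(AL) at the original ones, and above
    the new entropy by Klein's inequality. *)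
Theorem reduce_ancilla (A B L Q : finType) (phi : A -> B -> L -> Q -> C) :
  fnsq (cutAB phi) = 1 ->
  exists phi' : A -> B -> L -> ((A * B) * (A * B)) * bool -> C,
    gram (cutAB phi') = gram (cutAB phi) /\ vN (cutAL phi') <= vN (cutAL phi).
Proof.
move=> phi1; have [K [p [E [dE sE]]]] := sdec_exists (cutAL phi).
have [[a0 b0] [[l0 q0] _]] := fnsq_inhabited phi1.
pose z q (x : (A * B) * (A * B)) := \sum_l phi x.1.1 x.1.2 l q * (phi x.2.1 x.2.2 l q)^*.
pose v q (n : ((A * B) * (A * B)) * bool) := if n.2 then complex.Re (z q n.1) else complex.Im (z q n.1).
(* The trace, positive on each [q] that occurs in [phi]. *)
pose tau (n : ((A * B) * (A * B)) * bool) : R := (n.2 && (n.1.1 == n.1.2))%:R.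
pose t q := \sum_(w : A * B) \sum_l nsq (phi w.1 w.2 l q).
have tE q : \sum_n tau n * v q n = t q.
  rewrite sum_pair sum_pair; apply: eq_bigr => w _ /=.
  rewrite (bigD1 w) //= [X in _ + X]big1 ?addr0 => [|w' /negPf ne]; last first.
    by rewrite big_bool /tau /= eq_sym ne !mul0r addr0.
  rewrite big_bool /tau /v /= eqxx mul1r mul0r addr0 /z Re_sum.
  by apply: eq_bigr => l _; rewrite -nsqE.
have t0 q : 0 <= t q by apply: sumr_ge0 => w _; apply: sumr_ge0 => l _; exact: nsq_ge0.
have tz q : t q = 0 -> forall a b l, phi a b l q = 0.
  move=> tq a b l; apply: (fnsq_eq0 (M := fun w l => phi w.1 w.2 l q) (a, b) l).
  exact: tq.
(* Unit weights, set to zero on vectors absent from [phi], where the trace is not positive. *)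
pose w q : R := (t q != 0)%:R.
pose c q := - \sum_j ln (p j) * \sum_b nsq ((adj E ** cutAL phi) j (b, q)).
have w0 q : 0 <= w q by exact: ler0n.
have wt q : w q != 0 -> 0 < \sum_n tau n * v q n.
  by rewrite tE lt0r t0 andbT /w; case: (t q != 0); rewrite ?eqxx.
have [h [w' [w'0 w'v w'c]]] := sparse_weights c q0 w0 wt.
have w'z x : \sum_i (w' i)%:C%C * z (h i) x = \sum_q z q x.
  transitivity (\sum_q (w q)%:C%C * z q x); last first.
    apply: eq_bigr => q _; rewrite /w; case: eqVneq => [e|_]; last by rewrite mul1r.
    by rewrite /z big1 ?mulr0 // => l _; rewrite tz // mul0r.
  apply/eqP; rewrite eq_complex !Re_sum !Im_sum; apply/andP; split; apply/eqP.
    have := w'v (x, true); rewrite /v /= => e.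
    by under eq_bigr do rewrite ReZ; under [RHS]eq_bigr do rewrite ReZ.
  have := w'v (x, false); rewrite /v /= => e.
  by under eq_bigr do rewrite ImZ; under [RHS]eq_bigr do rewrite ImZ.
pose phi' a b l i := (Num.sqrt (w' i))%:C%C * phi a b l (h i).
have sw i : Num.sqrt (w' i) ^+ 2 = w' i by rewrite sqr_sqrtr.
have gE : gram (cutAB phi') = gram (cutAB phi).
  apply: fext => x y; rewrite /gram /fmul !sum_pair exchange_big [RHS]exchange_big /=.
  rewrite -(w'z (x, y)); apply: eq_bigr => i _; rewrite /z big_distrr /=.
  apply: eq_bigr => l _; rewrite /cutAB /adj /phi' /= rmorphM /= conjC_realC.
  by rewrite -{3}(sw i) expr2 rmorphM /=; ring.
exists phi'; split; first exact: gE.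
(* [phi'] arises from [phi] by a map on the B, Q side, so the new rho_AL keeps its support in the
   span of [E], as Klein's inequality requires. *)
pose P (x : B * Q) (y : B * (((A * B) * (A * B)) * bool)) : C :=
  (x.1 == y.1)%:R * (x.2 == h y.2)%:R * (Num.sqrt (w' y.2))%:C%C.
have phiP : cutAL phi' = cutAL phi ** P.
  apply: fext => x [b i]; rewrite [RHS]sum_pair (bigD1 b) //= [X in _ + X]big1 ?addr0.
    rewrite (bigD1 (h i)) //= [X in _ + X]big1 ?addr0 => [|q /negPf ne].
      by rewrite /P /cutAL /= !eqxx !mul1r mulrC.
    by rewrite /P /= ne mulr0 mul0r mulr0.
  by move=> b' /negPf ne; apply: big1 => q _; rewrite /P /= ne !mul0r mulr0.
have EphiP : E ** (adj E ** cutAL phi') = cutAL phi'.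
  by rewrite phiP !fmulA -(fmulA E) (gram_support dE).
have [K' [p' [E' [dE' ->]]]] := sdec_exists (cutAL phi').
have phi1' : fnsq (cutAL phi') = 1.
  by rewrite fnsq_cutAL -phi1; apply: complexI; rewrite -!ftr_gram gE.
apply: le_trans (klein dE' dE (sdec_support dE' EphiP) _) _.
  by rewrite (sdec_gram_sum dE) (sdec_gram_sum dE') phi1' fnsq_cutAL phi1.
have crossE (D : finType) (N : A -> B -> L -> D -> C) : cross (gram (cutAL N)) p E =
    \sum_q (- \sum_j ln (p j) * \sum_b nsq ((adj E ** cutAL N) j (b, q))).
  rewrite cross_gram sumrN; congr (- _); rewrite exchange_big; apply: eq_bigr => j _ /=.
  by rewrite -big_distrr sum_pair exchange_big.
have self : vN (cutAL phi) = cross (gram (cutAL phi)) p E.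
  rewrite sE cross_gram /Ent; congr (- _); apply: eq_bigr => j _.
  by rewrite (sdec_row_nsq j dE) mulrC.
rewrite self !crossE.
have cw : \sum_q w q * c q = \sum_q c q.
  apply: eq_bigr => q _; rewrite /w; case: eqVneq => [e|_]; last by rewrite mul1r.
  rewrite mul0r /c big1 ?oppr0 // => j _; rewrite big1 ?mulr0 // => b _.
  rewrite (_ : (adj E ** cutAL phi) j (b, q) = 0); first by rewrite /nsq /= expr0n /= addr0.
  by apply: big1 => x _; rewrite /cutAL tz // mulr0.
rewrite -/(\sum_q c q) -cw; apply: le_trans w'c.
rewrite le_eqVlt; apply/orP; left; apply/eqP; apply: eq_bigr => i _.
rewrite /c mulrN; congr (- _); rewrite big_distrr; apply: eq_bigr => j _ /=.
rewrite mulrCA; congr (_ * _); rewrite big_distrr; apply: eq_bigr => b _ /=.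
rewrite -[in RHS](sw i) -nsqZ; congr nsq; rewrite /fmul big_distrr /=.
by apply: eq_bigr => x _; rewrite /cutAL /phi' /=; ring.
Qed.

End Reduction.

Local Open Scope classical_set_scope.

(** * Diagonal entropies *)

Section Variational.
Variable R : realType.
Local Notation C := R[i].

Definition xlnx (x : R) : R := x * ln x.

Definition diag_ent (T U : finType) (V : T -> T -> C) (M : T -> U -> C) : R :=
  - \sum_i xlnx (\sum_u nsq ((adj V ** M) i u)).

(** Klein's inequality against the diagonal part of the state in the basis [V]: the cross term is
    the Shannon entropy of that diagonal. *)
Lemma vN_le_diag (T U : finType) (V : T -> T -> C) (M : T -> U -> C) :
  adj V ** V = @fid R T -> V ** adj V = @fid R T -> vN M <= diag_ent V M.
Proof.
move=> VV VV'; pose q i := \sum_u nsq ((adj V ** M) i u).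
have q0 i : 0 <= q i by apply: sumr_ge0 => u _; exact: nsq_ge0.
(* Zero diagonal entries are dropped, as a decomposition admits positive eigenvalues only. *)
pose r (k : {i | q i != 0}) := q (val k).
pose F t (k : {i | q i != 0}) := V t (val k).
have FF : adj F ** F = @fid R _.
  apply: fext => k l; transitivity ((adj V ** V) (val k) (val l)) => //.
  by rewrite VV /fid val_eqE.
have dF : sdec (F ** (dg r ** adj F)) r F.
  by split=> // k; rewrite lt0r (valP k) q0.
have sumr (G : T -> R) : (forall i, q i = 0 -> G i = 0) -> \sum_(k : {i | q i != 0}) G (val k) = \sum_i G i.
  move=> G0; rewrite -(sum_sig (fun i => q i != 0) G) [RHS](bigID (fun i => q i != 0)) /=.
  rewrite [X in _ = _ + X]big1 ?addr0 //.
  by move=> i /negPn /eqP /G0.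
have FM : F ** (adj F ** M) = M.
  apply: bessel_eq => //; transitivity (fnsq (adj V ** M)); last first.
    apply: support_fnsq => //; by rewrite fmulA VV' fmul1l.
  exact: (sumr q).
have [K [p [E [dE ->]]]] := sdec_exists M.
apply: le_trans (klein dE dF (sdec_support dE FM) _) _.
  rewrite (sdec_gram_sum dE) (sumr q) // -/(fnsq (adj V ** M)); exact: bessel.
rewrite cross_gram /diag_ent lerN2 le_eqVlt; apply/orP; left; apply/eqP.
rewrite -(sumr (fun i => xlnx (q i))); last by move=> i e; rewrite e /xlnx mul0r.
by apply: eq_bigr => k _; rewrite /xlnx mulrC.
Qed.

(** With [vN_le_diag], the entropy is a minimum over orthonormal bases of an explicit function of
    the amplitudes, so minimising jointly over states and bases minimises over states. *)
Lemma vN_diag (T U : finType) (M : T -> U -> C) :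
  exists V : T -> T -> C,
    [/\ adj V ** V = @fid R T, V ** adj V = @fid R T & vN M = diag_ent V M].
Proof.
pose A : 'M[C]_#|T| := \matrix_(i, j) gram M (enum_val i) (enum_val j).
pose N (i : 'I_#|T|) := M (enum_val i).
have AE i j : A i j = gram N i j by rewrite mxE.
have [PP PP' d_re Aeq eA] := spectral_gram AE.
set P := spectralmx A in PP PP' Aeq; set d := spectral_diag A in d_re Aeq eA.
have vNE : vN M = entropy A by apply/esym/(entropy_gram (enum_val_bij T)) => i j; rewrite mxE.
pose V t s : C := (P (enum_rank s) (enum_rank t))^*.
have rk := @enum_rank_bij T.
exists V; split.
- apply: fext => s s'; rewrite /fmul /adj /V.
  transitivity ((P *m P^t*) (enum_rank s) (enum_rank s')).
    rewrite mxE [RHS](reindex enum_rank) /=; last exact/onW_bij.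
    by apply: eq_bigr => t _; rewrite !mxE conjCK.
  by rewrite PP mxE /fid (inj_eq enum_rank_inj).
- apply: fext => t t'; rewrite /fmul /adj /V.
  transitivity ((P^t* *m P) (enum_rank t) (enum_rank t')).
    rewrite mxE [RHS](reindex enum_rank) /=; last exact/onW_bij.
    by apply: eq_bigr => s _; rewrite !mxE conjCK.
  by rewrite PP' mxE /fid (inj_eq enum_rank_inj).
rewrite vNE eA /diag_ent; congr (- _).
rewrite [LHS](reindex enum_rank) /=; last exact/onW_bij.
apply: eq_bigr => s _; rewrite -/(xlnx _); congr xlnx.
apply: complexI; rewrite (d_re _).2 -gram_diag -conj_gram.
transitivity ((P *m A *m P^t*) (enum_rank s) (enum_rank s)).
  by rewrite Aeq !mulmxA PP mul1mx -mulmxA PP mulmx1 mxE eqxx mulr1n.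
rewrite -mulmxA mxE (reindex enum_rank) /=; last exact/onW_bij.
apply: eq_bigr => t _; rewrite /adj /V conjCK; congr (_ * _).
rewrite mxE (reindex enum_rank) /=; last exact/onW_bij.
by apply: eq_bigr => t' _; rewrite /V !mxE !enum_rankK.
Qed.

End Variational.

(** * Continuity of x ln x *)

Section Continuity.
Variable R : realType.
Local Notation C := R[i].

(** Sublinearity of [ln] at [1 / y] with [y] the square root of [x]; the factor 2 comes from
    [ln x = 2 * ln y]. *)
Lemma xlnx_bound (x : R) : 0 < x -> x < 1 -> `|xlnx x| <= 2 * Num.sqrt x.
Proof.
move=> x0 x1; set y := Num.sqrt x.
have y0 : 0 < y by rewrite sqrtr_gt0.
have xy : x = y ^+ 2 by rewrite sqr_sqrtr // ltW.
have lx : ln x < 0 by apply: ln_lt0; rewrite x0.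
rewrite /xlnx ler0_norm; last by rewrite nmulr_lle0 // ltW.
have iy : 0 < y^-1 by rewrite invr_gt0.
have := ln_sublinear iy; rewrite lnV ?posrE // => h.
rewrite xy lnXn // -mulr_natl.
have : y ^+ 2 * (- ln y) <= y ^+ 2 * y^-1 by rewrite ler_pM2l ?exprn_gt0 // ltW.
have -> : y ^+ 2 * y^-1 = y by field; rewrite gt_eqF.
lra.
Qed.

Lemma continuous_xlnx : continuous (@xlnx R).
Proof.
move=> x; have [x0|x0|->] := ltgtP x 0.
(* [ln] is zero on nonpositive reals, so [xlnx] vanishes left of the origin. *)
- rewrite /continuous_at {2}/xlnx ln0 ?mulr0; last exact: ltW.
  apply/cvgrPdist_lt => e e0; near=> y.
  have y0 : y <= 0 by near: y; apply: (@cvgr_le _ _ _ _ id x) => //; exact: cvg_id.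
  by rewrite /xlnx ln0 // mulr0 subrr normr0.
- apply: cvgM; first exact: cvg_id.
  exact: continuous_ln.
rewrite /continuous_at /xlnx mul0r; apply/cvgrPdist_lt => e e0.
near=> y; rewrite sub0r normrN.
have [y0|y0] := leP y 0; first by rewrite ln0 // mulr0 normr0.
have ye : `|y| < Num.min 1 ((e / 2) ^+ 2).
  near: y; apply: (@nbhs0_lt _ R^o); rewrite lt_min ltr01 exprn_gt0 // divr_gt0 //.
rewrite (gtr0_norm y0) lt_min in ye; case/andP: ye => y1 ye.
apply: le_lt_trans (xlnx_bound y0 y1) _.
have : Num.sqrt y < e / 2.
  rewrite -(@ltr_pXn2r _ 2) ?nnegrE ?sqrtr_ge0 ?divr_ge0 ?(ltW e0) // sqr_sqrtr //; exact: ltW.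
lra.
Unshelve. all: by end_near.
Qed.

End Continuity.

(** * Compactness *)

Section Compactness.
Variable R : realType.
Local Notation C := R[i].

Section ComplexContinuity.
Variable T : topologicalType.
Implicit Types f g : T -> C.

(** Continuity is tested on real and imaginary parts, so that only the topology of the reals is
    involved. *)
Definition ccont f := continuous (fun x => complex.Re (f x) : R) /\
  continuous (fun x => complex.Im (f x) : R).

Lemma continuous_sum (I : finType) (F : I -> T -> R) :
  (forall i, continuous (F i)) -> continuous (fun x => \sum_i F i x).
Proof. by move=> cF; apply: continuous_big => // x; exact: add_continuous. Qed.

Lemma ccont_mul f g : ccont f -> ccont g -> ccont (fun x => f x * g x).
Proof.
move=> [f1 f2] [g1 g2].
have e x : f x * g x = Complex (complex.Re (f x) * complex.Re (g x) - complex.Im (f x) * complex.Im (g x))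
    (complex.Re (f x) * complex.Im (g x) + complex.Im (f x) * complex.Re (g x)).
  by case: (f x) (g x) => a b [c d].
split=> x; under eq_fun do rewrite e /=.
  by apply: cvgB; apply: cvgM; [exact: f1|exact: g1|exact: f2|exact: g2].
by apply: cvgD; apply: cvgM; [exact: f1|exact: g2|exact: f2|exact: g1].
Qed.

Lemma ccont_conj f : ccont f -> ccont (fun x => (f x)^*).
Proof.
move=> [f1 f2]; have e x : (f x)^* = Complex (complex.Re (f x)) (- complex.Im (f x)).
  by case: (f x).
split=> x; under eq_fun do rewrite e /=; first exact: f1.
apply: cvgN; exact: f2.
Qed.

Lemma ccont_sum (I : finType) (F : I -> T -> C) :
  (forall i, ccont (F i)) -> ccont (fun x => \sum_i F i x).
Proof.
move=> cF; split.
  under eq_fun do rewrite Re_sum; apply: continuous_sum => i; exact: (cF i).1.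
under eq_fun do rewrite Im_sum; apply: continuous_sum => i; exact: (cF i).2.
Qed.

Lemma ccont_fmul (U V W : finType) (f : T -> U -> V -> C) (g : T -> V -> W -> C) u w :
  (forall u v, ccont (fun x => f x u v)) -> (forall v w, ccont (fun x => g x v w)) ->
  ccont (fun x => (f x ** g x) u w).
Proof. by move=> cf cg; apply: ccont_sum => v; apply: ccont_mul. Qed.

Lemma ccont_adj (U V : finType) (f : T -> U -> V -> C) u v :
  (forall u v, ccont (fun x => f x u v)) -> ccont (fun x => adj (f x) v u).
Proof. by move=> cf; exact: ccont_conj. Qed.

Lemma continuous_nsq f : ccont f -> continuous (fun x => nsq (f x)).
Proof.
move=> [f1 f2] x; rewrite /nsq; apply: cvgD.
  by under eq_fun do rewrite expr2; apply: cvgM; exact: f1.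
by under eq_fun do rewrite expr2; apply: cvgM; exact: f2.
Qed.

Lemma closed_ccont f (c : C) : ccont f -> closed [set x | f x = c].
Proof.
move=> [f1 f2].
rewrite (_ : [set x | f x = c] = ((fun x => complex.Re (f x)) @^-1` [set complex.Re c]) `&`
   ((fun x => complex.Im (f x)) @^-1` [set complex.Im c])).
  apply: closedI; [move/continuous_closedP : f1; apply|move/continuous_closedP : f2; apply];
    exact: closed_eq.
apply/seteqP; split=> x /= [] => [->//|e1 e2].
by apply/eqP; rewrite eq_complex e1 e2 !eqxx.
Qed.

Lemma closed_fun_eq (U V : finType) (f : T -> U -> V -> C) (c : U -> V -> C) :
  (forall u v, ccont (fun x => f x u v)) -> closed [set x | f x = c].
Proof.
move=> cf.
rewrite (_ : [set x | f x = c] = \bigcap_(w in @setT (U * V)%type) [set x | f x w.1 w.2 = c w.1 w.2]).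
  by apply: closed_bigI => w _; exact: closed_ccont.
apply/seteqP; split=> [x /= fx w _ /=|x H]; first by rewrite fx.
apply: fext => u v; exact: (H (u, v) I).
Qed.

End ComplexContinuity.

Section Minimiser.
Variables (A B L Q : finType) (rho : A * B -> A * B -> C).
Hypothesis rho1 : ftr rho = 1.

(** A pair of a purification and a basis of AL is stored as one real row vector of real and
    imaginary parts, so compactness becomes that of a closed subset of a cube. *)
Let J : finType := (((A * B) * (L * Q)) + ((A * L) * (A * L)))%type.
Let n := #|{: J * bool}|.
Let z (x : 'rV[R]_n) (i : J) : C := Complex (x 0 (enum_rank (i, true))) (x 0 (enum_rank (i, false))).
Let phiX (x : 'rV[R]_n) a b l q : C := z x (inl ((a, b), (l, q))).
Let VX (x : 'rV[R]_n) (t s : A * L) : C := z x (inr (t, s)).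

Let ccont_z i : ccont (fun x => z x i).
Proof. by split=> x; exact: coord_continuous. Qed.

Let S := [set x | gram (cutAB (phiX x)) = rho] `&`
  ([set x | adj (VX x) ** VX x = @fid R _] `&` [set x | VX x ** adj (VX x) = @fid R _]).

Let closed_S : closed S.
Proof.
apply: closedI.
  apply: closed_fun_eq => u v; apply: ccont_fmul => *; first exact: ccont_z.
  by apply: ccont_adj => *; exact: ccont_z.
apply: closedI; apply: closed_fun_eq => u v; apply: ccont_fmul => *;
  by [exact: ccont_z|apply: ccont_adj => *; exact: ccont_z].
Qed.

Let nsq_le (c : C) : nsq c <= 1 -> `|complex.Re c| <= 1 /\ `|complex.Im c| <= 1.
Proof.
rewrite /nsq => h; split; rewrite -(@ler_pXn2r _ 2) ?nnegrE // expr1n real_normK ?num_real //;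
  apply: le_trans h; by rewrite ?lerDl ?lerDr sqr_ge0.
Qed.

Let nsq_le_fnsq (T U : finType) (M : T -> U -> C) t u : nsq (M t u) <= fnsq M.
Proof.
rewrite /fnsq (bigD1 t) //= (bigD1 u) //= -addrA lerDl addr_ge0 //.
  by apply: sumr_ge0 => *; exact: nsq_ge0.
by apply: sumr_ge0 => *; apply: sumr_ge0 => *; exact: nsq_ge0.
Qed.

(** All coordinates lie in [-1, 1]: the squared norm of the purification is the trace of [rho], and
    the columns of the basis are unit vectors. *)
Let compact_S : compact S.
Proof.
apply: (subclosed_compact closed_S (@rV_compact R n (fun=> `[-1, 1]%classic) _)).
  by move=> i; exact: segment_compact.
move=> x [/= e1 [/= e2 e3]] k /=; rewrite in_itv /= -ler_norml.
have key i : nsq (z x i) <= 1.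
  case: i => [[[a b] [l q]]|[t s]].
    apply: le_trans (nsq_le_fnsq (cutAB (phiX x)) (a, b) (l, q)) _.
    by rewrite -lecR -ftr_gram e1 rho1.
  have := congr1 (fun f => f s s) e2; rewrite col_nsq /fid eqxx => /complexI <-.
  rewrite (bigD1 t) //= lerDl; apply: sumr_ge0 => *; exact: nsq_ge0.
rewrite -(enum_valK k); case: (enum_val k) => i b.
by have [h1 h2] := nsq_le (key i); case: b.
Qed.

Theorem minimiser_exists (phi0 : A -> B -> L -> Q -> C) : gram (cutAB phi0) = rho ->
  exists phi : A -> B -> L -> Q -> C, gram (cutAB phi) = rho /\
    forall phi' : A -> B -> L -> Q -> C, gram (cutAB phi') = rho -> vN (cutAL phi) <= vN (cutAL phi').
Proof.
pose f x := diag_ent (VX x) (cutAL (phiX x)).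
have cf : continuous f.
  pose h x t := \sum_u nsq ((adj (VX x) ** cutAL (phiX x)) t u).
  have ch t : continuous (h ^~ t).
    apply: continuous_sum => u; apply: continuous_nsq; apply: ccont_fmul => *.
      by apply: ccont_adj => *; exact: ccont_z.
    exact: ccont_z.
  have cs : continuous (fun x => \sum_t xlnx (h x t)).
    apply: continuous_sum => t x; apply: (@continuous_comp _ _ _ (h ^~ t) (@xlnx R)).
      exact: ch.
    exact: continuous_xlnx.
  by move=> x; exact: (cvgN (cs x)).
have param (phi : A -> B -> L -> Q -> C) (V : A * L -> A * L -> C) :
    exists x, phiX x = phi /\ VX x = V.
  pose F (i : J) : C := match i with inl w => phi w.1.1 w.1.2 w.2.1 w.2.2 | inr w => V w.1 w.2 end.
  exists (\row_k (let w := enum_val k in if w.2 then complex.Re (F w.1) else complex.Im (F w.1))).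
  split; [do 4!(apply/funext => ?)|do 2!(apply/funext => ?)];
    rewrite /phiX /VX /z !mxE !enum_rankK /=; by apply/eqP; rewrite eq_complex !eqxx.
have inS (phi : A -> B -> L -> Q -> C) : gram (cutAB phi) = rho ->
    exists x, S x /\ f x = vN (cutAL phi).
  move=> e; have [V [V1 V2 eV]] := vN_diag (cutAL phi).
  have [x [ex1 ex2]] := param phi V; exists x; rewrite /S /f /= ex1 ex2; split.
    by split.
  exact: esym eV.
move=> e0; have [x0 [Sx0 _]] := inS _ e0.
have [c] := compact_EVT_min (ex_intro _ x0 Sx0) compact_S (continuous_subspaceT cf).
rewrite inE => Sc cmin; exists (phiX c); case: (Sc) => [/= e1 [/= e2 e3]]; split=> [//|phi' e'].
have [x [Sx fx]] := inS _ e'; rewrite -fx.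
(* The basis found with the minimiser is not known to diagonalise its state; the inequality goes in
   the required direction, and every competitor is paired with its own eigenbasis. *)
apply: le_trans (vN_le_diag _ e2 e3) _.
by apply: cmin; rewrite inE.
Qed.

End Minimiser.

End Compactness.

(** * Attainment of the minimum *)

Section Attainment.
Variable R : realType.
Local Notation C := R[i].

Lemma gram_cutAB_swap (A B L Q : finType) (phi : A -> B -> L -> Q -> C) w w' :
  gram (cutAB (fun j i q l => phi i j l q)) w w' = gram (cutAB phi) (w.2, w.1) (w'.2, w'.1).
Proof. by rewrite /gram /fmul !sum_pair exchange_big. Qed.

(** The new ancilla types depend on [A] and [B] only, so one minimisation in fixed dimensions can be
    compared with all purifications. The second reduction acts on [L] after the exchange of A, L
    with B, Q, which preserves the entropy by purity. *)
Lemma reduce_ancillas (A B L Q : finType) (phi : A -> B -> L -> Q -> C) :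
  fnsq (cutAB phi) = 1 ->
  exists phi' : A -> B -> ((B * A) * (B * A)) * bool -> ((A * B) * (A * B)) * bool -> C,
    gram (cutAB phi') = gram (cutAB phi) /\ vN (cutAL phi') <= vN (cutAL phi).
Proof.
move=> phi1; have [phi' [e' le']] := reduce_ancilla phi1.
have fnsqE (X Y L1 Q1 L2 Q2 : finType) (u : X -> Y -> L1 -> Q1 -> C) (v : X -> Y -> L2 -> Q2 -> C) :
    gram (cutAB u) = gram (cutAB v) -> fnsq (cutAB u) = fnsq (cutAB v).
  by move=> e; apply: complexI; rewrite -!ftr_gram e.
have phi1' : fnsq (cutAB phi') = 1 by rewrite (fnsqE _ _ _ _ _ _ _ _ e').
have phi1s : fnsq (cutAB (fun j i q l => phi' i j l q)) = 1.
  rewrite -phi1'; have bu : bijective (fun w : (B * A) * ((((A * B) * (A * B)) * bool) * L) =>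
      ((w.1.2, w.1.1), (w.2.2, w.2.1))).
    by exists (fun w => ((w.1.2, w.1.1), (w.2.2, w.2.1))) => -[[? ?] [? ?]].
  exact: (fnsq_reindex bu (fun _ _ => erefl)).
have [phi2 [e2 le2]] := reduce_ancilla phi1s.
exists (fun i j l q => phi2 j i q l); split.
  apply: fext => w w'; rewrite (gram_cutAB_swap phi2) e2 (gram_cutAB_swap phi') -e'.
  by case: w w' => ? ? [? ?].
have vN_swap (X Y L' Q' : finType) (u : X -> Y -> L' -> Q' -> C) :
    vN (cutAL (fun j i q l => u i j l q)) = vN (cutAL u) := vN_trp (cutAL u).
rewrite (vN_swap _ _ _ _ phi2); apply: le_trans le2 _.
by rewrite (vN_swap _ _ _ _ phi').
Qed.

Theorem purification_minimiser (A B D : finType) (psi : A -> B -> D -> C) :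
  fnsq (fun (w : A * B) k => psi w.1 w.2 k) = 1 ->
  exists (L Q : finType) (phi : A -> B -> L -> Q -> C),
    gram (cutAB phi) = gram (fun (w : A * B) k => psi w.1 w.2 k) /\
    forall (L' Q' : finType) (phi' : A -> B -> L' -> Q' -> C),
      gram (cutAB phi') = gram (fun (w : A * B) k => psi w.1 w.2 k) ->
      vN (cutAL phi) <= vN (cutAL phi').
Proof.
set rho := gram _ => psi1.
have norm1 (L Q : finType) (phi : A -> B -> L -> Q -> C) :
    gram (cutAB phi) = rho -> fnsq (cutAB phi) = 1.
  by move=> e; apply: complexI; rewrite -ftr_gram e ftr_gram psi1.
have rho1 : ftr rho = 1 by rewrite ftr_gram psi1.
(* [psi] itself, with a trivial [Q], shows that a purification exists. *)
have e0 : gram (cutAB (fun i j k (_ : unit) => psi i j k)) = rho.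
  by apply: fext => w w'; rewrite [LHS]sum_pair; apply: eq_bigr => k _; rewrite sum_unit.
have [phi0 [e1 _]] := reduce_ancillas (norm1 _ _ _ e0).
have [phi [e min]] := minimiser_exists rho1 (etrans e1 e0).
exists _, _, phi; split=> [//|L' Q' phi' e'].
have [phi2 [e2 le2]] := reduce_ancillas (norm1 _ _ _ e').
exact: le_trans (min _ (etrans e2 e')) le2.
Qed.

Lemma inf_minimum (E : set R) (s : R) : E s -> (forall t, E t -> s <= t) -> inf E = s.
Proof.
move=> Es smin; apply/eqP; rewrite eq_le; apply/andP; split.
  by apply: ge_inf => //; exists s.
by apply: lb_le_inf; [exists s|].
Qed.

Lemma EP_minimum (a b c : nat) (psi : 'cV[C]_(a * b * c)) (L Q : finType)
    (phi : 'I_a -> 'I_b -> L -> Q -> C) :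
  pure_state psi ->
  gram (cutAB phi) = gram (fun (w : 'I_a * 'I_b) k => psi (tens3 w.1 w.2 k) 0) ->
  (forall (L' Q' : finType) (phi' : 'I_a -> 'I_b -> L' -> Q' -> C),
      gram (cutAB phi') = gram (fun (w : 'I_a * 'I_b) k => psi (tens3 w.1 w.2 k) 0) ->
      vN (cutAL phi) <= vN (cutAL phi')) ->
  EP (ptrace_r (density psi)) = vN (cutAL phi).
Proof.
move=> psi1 e min; apply: inf_minimum => [|t [l [r [v [pv ->]]]]]; last first.
  by rewrite marginal13E; apply: min; exact: (purifiesP v psi1).1 pv.
have [v ev] := cvec4_exists (fun i j (k : 'I_#|L|) (z : 'I_#|Q|) => phi i j (enum_val k) (enum_val z)).
exists #|L|, #|Q|, v; split.
  apply/(purifiesP v psi1); rewrite ev -e; apply: fext => w w'.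
  rewrite [LHS]sum_pair [RHS]sum_pair [RHS](reindex (enum_val : 'I_#|L| -> L)) /=; last first.
    exact/onW_bij/enum_val_bij.
  apply: eq_bigr => k _; rewrite [RHS](reindex (enum_val : 'I_#|Q| -> Q)) //=.
  exact/onW_bij/enum_val_bij.
rewrite marginal13E ev.
have bij2 (X T : finType) : bijective (fun w : X * 'I_#|T| => (w.1, enum_val w.2)).
  by exists (fun w => (w.1, enum_rank w.2)) => -[x y] /=; rewrite ?enum_valK ?enum_rankK.
exact: esym (vN_bij (cutAL phi) (bij2 _ L) (bij2 _ Q)).
Qed.

End Attainment.

Theorem theorem2 (R : realType) (a b c : nat) (psi : 'cV[R[i]]_(a * b * c)) :
  pure_state psi ->
  triangle_up_to_isometries psi <-> g (ptrace_r (density psi)) = 0.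
Proof.
move=> psi1; pose f i j k := psi (tens3 i j k) 0.
have f1 : fnsq (fun (w : 'I_a * 'I_b) k => f w.1 w.2 k) = 1.
  by move/pure_stateP : psi1 => <-; rewrite sum_tens2 sum_tens2 /fnsq sum_pair.
(* As the bound holds for every purification, a purification with equality is a minimiser; this
   settles the direction from triangle states. *)
have lower (L Q : finType) (phi : 'I_a -> 'I_b -> L -> Q -> R[i]) :
    gram (cutAB phi) = gram (fun (w : 'I_a * 'I_b) k => f w.1 w.2 k) ->
    mutinf f <= 2 * vN (cutAL phi).
  move=> e; have phi1 : fnsq (cutAB phi) = 1.
    by apply: complexI; rewrite -ftr_gram e ftr_gram f1.
  have em : mutinf f = mutinf (fun i j (w : L * Q) => phi i j w.1 w.2).
    by apply: mutinf_gram; exact: esym e.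
  rewrite em; exact: mutinf_le phi1.
have gE (L Q : finType) (phi : 'I_a -> 'I_b -> L -> Q -> R[i]) :
    EP (ptrace_r (density psi)) = vN (cutAL phi) ->
    g (ptrace_r (density psi)) = 2 * vN (cutAL phi) - mutinf f.
  by move=> e; rewrite /g e mutual_informationE.
rewrite triangleP; split=> [tri|g0].
  have [L [Q [phi [e opt]]]] := triangle_optimal tri.
  rewrite (gE L Q phi) ?opt ?subrr //; apply: (EP_minimum psi1 e) => L' Q' phi' e'.
  by rewrite -(ler_pM2l (ltr0Sn R 1)) opt; exact: lower.
(* Attainment enters here: vanishing of [g] yields a purification with equality because the infimum
   is a minimum. *)
have [L [Q [phi [e min]]]] := purification_minimiser f1.
apply: (optimal_triangle f1 e).
have := gE L Q phi (EP_minimum psi1 e min); rewrite g0 => /esym/eqP.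
by rewrite subr_eq0 => /eqP ->.
Qed.
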